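(* Let $G$ be a metrizable compact group and let $(\xi_n)_{n\in\mathbb{N}}$ be an i.i.d. sequence of $G$-valued random variables whose common distribution has support $S$. For $n\in\mathbb{N}$ let $S^n=\{g_1\cdots g_n: g_j\in S\text{ for }j=1,\dots,n\}$. Then the sequence $(\xi_1\cdots\xi_n)_{n\in\mathbb{N}}$ is, with probability one, uniformly distributed in $G$ if and only if $\overline{\bigcup_{n\in\mathbb{N}}S^n}=G$.
   Context: $G$ is a metrizable compact group, written multiplicatively, with Borel $\sigma$-algebra $\mathcal{B}_G$; $\lambda_G$ denotes the normalized Haar (probability) measure on $(G,\mathcal{B}_G)$, and $C(G)$ the space of continuous complex-valued functions on $G$. Here $\mathbb{N}=\{1,2,3,\dots\}$. A measurable function $\gamma:[0,+\infty)\to G$ is continuously uniformly distributed (c.u.d.) in $G$ if $$\lim_{T\to+\infty}\frac1T\int_0^T\varphi(\gamma(t))\,\mathrm{d}t=\int_G\varphi\,\mathrm{d}\lambda_G\quad\text{for all }\varphi\in C(G).$$ A sequence $(g_n)_{n\in\mathbb{N}}$ in $G$ is uniformly distributed (u.d.) in $G$ if the function $t\mapsto g_{\lfloor t\rfloor+1}$ is c.u.d. in $G$, where $\lfloor t\rfloor$ is the largest integer not larger than $t$. The support of a probability measure $\nu$ on $(G,\mathcal{B}_G)$ is the smallest closed set $F\subseteq G$ with $\nu(F)=1$. *)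

(* Defs.v *)
(* MathComp / MathComp-Analysis. *)
From HB Require Import structures.
From mathcomp Require Export all_boot all_order all_algebra finmap.
From mathcomp Require Export all_classical all_reals all_analysis.
From mathcomp Require Export complex.

Set Implicit Arguments.
Unset Strict Implicit.
Unset Printing Implicit Defensive.

Import Order.TTheory GRing.Theory Num.Theory.
Import numFieldTopology.Exports numFieldNormedType.Exports.

Local Open Scope classical_set_scope.
Local Open Scope ring_scope.

HB.mixin Record isTopologicalGroup G of Topological G & Group G := {
  mulg_continuous : continuous (fun x : G * G => (x.1 * x.2)%g) ;
  invg_continuous : continuous (fun x : G => (x^-1)%g)
}.

(* The point required by [PointedTopological] is only there because the
   library's generated sigma-algebras live on pointed types; it is arbitrary
   and has no relation to the unit of the group. *)
#[short(type="topologicalGroupType")]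
HB.structure Definition TopologicalGroup :=
  { G of PointedTopological G & Group G & isTopologicalGroup G }.

Definition metrizable (R : realType) (T : topologicalType) : Prop :=
  exists d : T -> T -> R,
    [/\ forall x y, d x y = 0 <-> x = y,
        forall x y, d x y = d y x,
        forall x y z, d x z <= d x y + d y z &
        forall x, nbhs x = filter_from [set e : R | 0 < e]
                             (fun e => [set y | d x y < e])].

Notation borel T := (g_sigma_algebraType (@open T)).

Section haar_and_uniform_distribution.
Context {R : realType} {G : topologicalGroupType}.

(* On a compact group the left-invariant probability measure is unique and is
   also right-invariant. *)
Definition normalized_haar (lambda : probability (borel G) R) : Prop :=
  forall (g : G) (A : set (borel G)), measurable A ->
    lambda [set (g * x : G)%g | x in A] = lambda A.

(* [R[i]] carries its usual topology through the alias [R[i]^o]. *)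
Definition Cintegral d (T : measurableType d) (mu : {measure set T -> \bar R})
    (D : set T) (f : T -> R[i]) : R[i] :=
  ((\int[mu]_(x in D) complex.Re (f x)) +i*
   (\int[mu]_(x in D) complex.Im (f x)))%C.

Definition cud (lambda : probability (borel G) R) (gamma : R -> borel G) :=
  measurable_fun (`[0, +oo[ : set R) gamma /\
  forall phi : G -> R[i]^o, continuous phi ->
    (fun T : R => (T^-1)%:C%C *
       Cintegral (@lebesgue_measure R) `[0, T] (fun t => phi (gamma t))
       : R[i]^o) @ +oo
    --> (Cintegral lambda [set: borel G] phi : R[i]^o).

(* Sequences are indexed from 0: [g n] stands for the (n+1)-st term, so the
   step function taking the value of the term of index floor(t) + 1 at t is
   [g] evaluated at floor(t). *)
Definition ud (lambda : probability (borel G) R) (g : nat -> G) : Prop :=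
  cud lambda (fun t : R => g `|Num.floor t|%N).

Definition is_support (nu : probability (borel G) R) (S : set G) : Prop :=
  [/\ closed S, nu S = 1%E &
      forall F : set G, closed F -> nu F = 1%E -> S `<=` F].

End haar_and_uniform_distribution.

Definition power_set_product (G : groupType) (S : set G) (n : nat) : set G :=
  [set (\prod_(j < n) g j)%g | g in [set g : 'I_n -> G | forall j, S (g j)]].

Section iid.
Context {d d' : measure_display} {Omega : measurableType d}
  {T : measurableType d'} {R : realType} (P : probability Omega R).

Definition mutually_independent (I : choiceType) (X : I -> {RV P >-> T}) :=
  forall (J : {fset I}) (A : I -> set T),
    (forall i, i \in J -> measurable (A i)) ->
    P (\bigcap_(i in [set` J]) (X i @^-1` A i)) =
    (\prod_(i <- J) P (X i @^-1` A i))%E.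

Definition iid_with_law (X : nat -> {RV P >-> T}) (nu : probability T R) :=
  mutually_independent X /\
  forall n (A : set T), measurable A -> distribution P (X n) A = nu A.

End iid.

(* Main.v *)
Require Import Defs.
From HB Require Import structures.
From mathcomp Require Import measurable_realfun zify lra ring.

(* Let P f x = int f (x y) nu(dy).  Along the walk X_n = xi_1 ... xi_n the
   differences f (X_{k+1}) - P f (X_k) are bounded and pairwise orthogonal, so
   their Cesaro means tend to 0 almost surely; hence f and P f, and thus f and
   any h obtained from f by repeatedly averaging iterates of P, have the same
   Cesaro means along the walk.  All these h share a two-sided modulus of
   continuity with f.
   When the powers of S are dense, finitely many powers of nu jointly charge
   every translate of a given neighbourhood, so a suitable average of iterates
   of P decreases the oscillation of h by a fixed amount as long as it exceeds
   a given level: some h is almost constant, the constant being int f dlambda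
   as P preserves Haar measure.  A countable family spanning a dense subspace
   of C(G) makes the exceptional set independent of f.  Conversely the walk
   stays in the closure of the union of the powers of S, whose complement would
   carry a bump function of positive Haar integral. *)

Set Implicit Arguments.
Unset Strict Implicit.
Unset Printing Implicit Defensive.

Import Order.TTheory GRing.Theory Num.Theory.
Import numFieldTopology.Exports numFieldNormedType.Exports.

Local Open Scope classical_set_scope.
Local Open Scope ring_scope.

(** * Bounded measurable functions *)

(** The working class of integrands: it is stable under the operations below and consists of
    functions integrable for every probability measure, so [Rintegral] is linear and monotone on it
    without further integrability conditions. *)
Definition bounded_measurable {R : realType} d {T : measurableType d}
    (f : T -> R) : Prop :=
  measurable_fun [set: T] f /\ exists c : R, forall x, `|f x| <= c.

Section bounded_measurable.
Context {R : realType} {d : measure_display} {T : measurableType d}.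
Implicit Types f g : T -> R.

Lemma bounded_measurable_cst (c : R) : bounded_measurable (fun _ : T => c).
Proof. by split; [exact: measurable_cst|exists `|c|]. Qed.

Lemma bounded_measurableD f g : bounded_measurable f -> bounded_measurable g ->
  bounded_measurable (fun x => f x + g x).
Proof.
move=> [mf [a fa]] [mg [b gb]]; split; first exact: measurable_funD.
by exists (a + b) => x; rewrite (le_trans (ler_normD _ _))// lerD.
Qed.

Lemma bounded_measurableM f g : bounded_measurable f -> bounded_measurable g ->
  bounded_measurable (fun x => f x * g x).
Proof.
move=> [mf [a fa]] [mg [b gb]]; split; first exact: measurable_funM.
by exists (a * b) => x; rewrite normrM ler_pM.
Qed.

Lemma bounded_measurableZ (c : R) f : bounded_measurable f ->
  bounded_measurable (fun x => c * f x).
Proof. by apply: bounded_measurableM; exact: bounded_measurable_cst. Qed.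

Lemma bounded_measurableB f g : bounded_measurable f -> bounded_measurable g ->
  bounded_measurable (fun x => f x - g x).
Proof.
move=> bf /(bounded_measurableZ (-1)) bg.
by have := bounded_measurableD bf bg; under eq_fun do rewrite mulN1r.
Qed.

Lemma bounded_measurable_sum (I : Type) (s : seq I) (F : I -> T -> R) :
  (forall i, bounded_measurable (F i)) ->
  bounded_measurable (fun x => \sum_(i <- s) F i x).
Proof.
move=> bF; elim: s => [|i s IH].
  by under eq_fun do rewrite big_nil; exact: bounded_measurable_cst.
by under eq_fun do rewrite big_cons; exact: bounded_measurableD.
Qed.

Lemma bounded_measurable_comp d' (T' : measurableType d') (h : T' -> T) f :
  measurable_fun setT h -> bounded_measurable f ->
  bounded_measurable (fun x => f (h x)).
Proof.
move=> mh [mf [c fc]]; split; first exact: (measurableT_comp mf mh).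
by exists c => x; exact: fc.
Qed.

Lemma bounded_measurable_indic (A : set T) : measurable A ->
  bounded_measurable (\1_A : T -> R).
Proof.
move=> mA; split; first exact: measurable_indic.
exists 1 => x; rewrite indicE ger0_norm ?ler0n// -[leRHS]/(true%:R) ler_nat.
exact: leq_b1.
Qed.

Context (mu : probability T R).

Lemma bounded_measurable_integrable f :
  bounded_measurable f -> mu.-integrable setT (EFin \o f).
Proof.
move=> [mf [c fc]]; apply: (@le_integrable _ _ _ mu setT measurableT _
  (cst c%:E)).
- exact/measurable_EFinP.
- by move=> x _ /=; rewrite lee_fin (le_trans (fc x))// ler_norm.
- by apply: finite_measure_integrable_cst.
Qed.

Local Notation "\E f" := (Rintegral mu setT f) (at level 10).

Lemma bintD f g : bounded_measurable f -> bounded_measurable g ->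
  \E (fun x => f x + g x) = \E f + \E g.
Proof. by move=> bf bg; rewrite RintegralD//; exact: bounded_measurable_integrable. Qed.

Lemma bintB f g : bounded_measurable f -> bounded_measurable g ->
  \E (fun x => f x - g x) = \E f - \E g.
Proof. by move=> bf bg; rewrite RintegralB//; exact: bounded_measurable_integrable. Qed.

Lemma bintZ (c : R) f : bounded_measurable f ->
  \E (fun x => c * f x) = c * \E f.
Proof. by move=> bf; rewrite RintegralZl//; exact: bounded_measurable_integrable. Qed.

Lemma bint_cst (c : R) : \E (fun=> c) = c.
Proof. by rewrite Rintegral_cst// [X in fine X]probability_setT mulr1. Qed.

Lemma ler_bint f g : bounded_measurable f -> bounded_measurable g ->
  (forall x, f x <= g x) -> \E f <= \E g.
Proof.
by move=> bf bg fg; apply: le_Rintegral => //; exact: bounded_measurable_integrable.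
Qed.

Lemma bint_sum (I : Type) (s : seq I) (F : I -> T -> R) :
  (forall i, bounded_measurable (F i)) ->
  \E (fun x => \sum_(i <- s) F i x) = \sum_(i <- s) \E (F i).
Proof.
move=> bF; elim: s => [|i s IH].
  by under eq_Rintegral do rewrite big_nil; rewrite big_nil bint_cst.
under eq_Rintegral do rewrite big_cons.
rewrite big_cons -IH bintD//; exact: bounded_measurable_sum.
Qed.

Lemma bint_norm_le f (c : R) : bounded_measurable f ->
  (forall x, `|f x| <= c) -> `|\E f| <= c.
Proof.
move=> bf fc; rewrite ler_norml; apply/andP; split.
  rewrite -[leLHS]bint_cst; apply: ler_bint => //; first exact: bounded_measurable_cst.
  by move=> x; have := fc x; rewrite ler_norml => /andP[].
rewrite -[leRHS]bint_cst; apply: ler_bint => //; first exact: bounded_measurable_cst.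
by move=> x; have := fc x; rewrite ler_norml => /andP[].
Qed.

Lemma bint_indic (A : set T) : measurable A -> \E (\1_A) = fine (mu A).
Proof. by move=> mA; rewrite /Rintegral integral_indic// setIT. Qed.

Lemma bint_EFin f : bounded_measurable f ->
  (\int[mu]_x (f x)%:E)%E = (\E f)%:E.
Proof.
move=> bf; rewrite /Rintegral fineK//.
exact: integrable_fin_num (bounded_measurable_integrable bf).
Qed.

End bounded_measurable.

(** * Fubini's theorem for bounded integrands *)

Section bounded_fubini.
Context {R : realType} {d1 d2 : measure_display} {T1 : measurableType d1}
  {T2 : measurableType d2} (m1 : probability T1 R) (m2 : probability T2 R)
  (f : T1 * T2 -> R) (bf : bounded_measurable f).

Lemma bounded_measurable_pair1 x : bounded_measurable (fun y => f (x, y)).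
Proof.
have [mf [c fc]] := bf; split; last by exists c.
exact: (measurableT_comp mf (pair1_measurable x)).
Qed.

Lemma bounded_measurable_pair2 y : bounded_measurable (fun x => f (x, y)).
Proof.
have [mf [c fc]] := bf; split; last by exists c.
exact: (measurableT_comp mf (pair2_measurable y)).
Qed.

(** By Tonelli it suffices to bound the iterated integral of the absolute value, and a bound [c] on
    [f] survives both integrations because the measures have mass one. *)
Lemma prod_integrable : (m1 \x m2)%E.-integrable setT (EFin \o f).
Proof.
have [mf [c fc]] := bf.
have mEf : measurable_fun setT (EFin \o f) by exact/measurable_EFinP.
apply/integrable12ltyP => //.
apply: (@le_lt_trans _ _ (\int[m1]_x (cst c%:E) x)%E).
  apply: ge0_le_integral => //.
  - by move=> x _; apply: integral_ge0.
  - apply: (measurable_fun_fubini_tonelli_F (abse \o (EFin \o f))).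
      exact: measurableT_comp.
    by move=> z /=; rewrite lee_fin.
  - move=> x _; apply: (@le_trans _ _ (\int[m2]_y (cst c%:E) y)%E).
      apply: ge0_le_integral => //.
      + apply: measurableT_comp => //; apply/measurable_EFinP.
        by have [] := bounded_measurable_pair1 x.
      + by move=> y _ /=; rewrite lee_fin.
    by rewrite integral_cst// [X in (_ * X)%E]probability_setT mule1.
by rewrite integral_cst// [X in (_ * X)%E]probability_setT mule1 ltry.
Qed.

Lemma bounded_measurable_fubini :
  bounded_measurable (fun x => \int[m2]_y f (x, y)).
Proof.
have [_ [c fc]] := bf; split; last first.
  by exists c => x; apply: bint_norm_le => //; exact: bounded_measurable_pair1.
apply/measurable_EFinP.
rewrite [X in measurable_fun _ X](_ : _ = fun x => (\int[m2]_y (f (x, y))%:E)%E).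
  exact: (measurable_fubini_F prod_integrable).
by apply/funext => x /=; rewrite bint_EFin//; exact: bounded_measurable_pair1.
Qed.

Lemma bounded_fubini_prod :
  \int[(m1 \x m2)%E]_z f z = \int[m1]_x \int[m2]_y f (x, y).
Proof.
apply: EFin_inj; rewrite -[RHS]bint_EFin; last exact: bounded_measurable_fubini.
rewrite -[LHS]bint_EFin// -(integral12_prod_meas1 prod_integrable).
by apply: eq_integral => x _; rewrite -bint_EFin//; exact: bounded_measurable_pair1.
Qed.

End bounded_fubini.

Lemma bounded_fubini {R : realType} {d1 d2 : measure_display}
    {T1 : measurableType d1} {T2 : measurableType d2} (m1 : probability T1 R)
    (m2 : probability T2 R) (f : T1 * T2 -> R) : bounded_measurable f ->
  \int[m1]_x \int[m2]_y f (x, y) = \int[m2]_y \int[m1]_x f (x, y).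
Proof.
move=> bf; have bfs : bounded_measurable (fun z : T2 * T1 => f (z.2, z.1)).
  exact: bounded_measurable_comp (measurable_fun_pair measurable_snd measurable_fst) bf.
apply: EFin_inj; rewrite -[LHS]bint_EFin; last exact: bounded_measurable_fubini.
rewrite -[RHS]bint_EFin; last exact: (bounded_measurable_fubini m2 m1 bfs).
transitivity (\int[m1]_x \int[m2]_y (f (x, y))%:E)%E.
  by apply: eq_integral => x _; rewrite -bint_EFin//; exact: bounded_measurable_pair1.
rewrite (Fubini (prod_integrable m1 m2 bf)).
by apply: eq_integral => x _; rewrite -bint_EFin//; exact: bounded_measurable_pair2.
Qed.

(** * Compact groups *)

Section compact_group.
Context {R : realType} {G : topologicalGroupType}.
Implicit Types (f : G -> R) (x y a b u : G).

Lemma continuous_mulg (T : topologicalType) (h k : T -> G) :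
  continuous h -> continuous k -> continuous (fun t => h t * k t)%g.
Proof.
move=> ch ck t.
apply: (@continuous_comp _ _ _ (fun t => (h t, k t)) (fun z : G * G => (z.1 * z.2)%g)).
  by apply: cvg_pair => //=; [exact: ch|exact: ck].
exact: mulg_continuous.
Qed.

Lemma continuous_comp_fun (T U V : topologicalType) (h : T -> U) (k : U -> V) :
  continuous h -> continuous k -> continuous (fun t => k (h t)).
Proof. by move=> ch ck t; apply: continuous_comp; [exact: ch|exact: ck]. Qed.

Lemma continuous_sumr (T : topologicalType) (I : Type) (s : seq I) (F : I -> T -> R) :
  (forall i, continuous (F i)) -> continuous (fun t => \sum_(i <- s) F i t).
Proof.
move=> cF; elim: s => [|i s IH].
  by under eq_fun do rewrite big_nil; move=> x; exact: cvg_cst.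
by under eq_fun do rewrite big_cons; move=> x; apply: cvgD; [exact: cF|exact: IH].
Qed.

Lemma continuous_mulgr a : continuous (fun x : G => x * a)%g.
Proof. by apply: continuous_mulg => // x; [exact: cvg_id|exact: cvg_cst]. Qed.

Lemma continuous_mulgl a : continuous (fun x : G => a * x)%g.
Proof. by apply: continuous_mulg => // x; [exact: cvg_cst|exact: cvg_id]. Qed.

Lemma continuous_borel_measurable f : continuous f ->
  measurable_fun [set: borel G] (f : borel G -> R).
Proof.
move=> cf; apply: (measurability _ (RGenOInfty.measurableE R)) => _ [_ [x ->] <-].
rewrite setTI; apply: sub_sigma_algebra.
by move/continuousP : cf; apply; exact: interval_open.
Qed.

Lemma borel_measurableP d (T : measurableType d) (h : T -> borel G) :
  (forall U : set G, open U -> measurable (h @^-1` U)) -> measurable_fun setT h.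
Proof.
move=> mh; apply: (@measurability _ _ _ _ setT h (@open G)) => // _ [U oU <-].
by rewrite setTI; exact: mh.
Qed.

Lemma continuous_borel_map (h : G -> G) : continuous h ->
  measurable_fun [set: borel G] (h : borel G -> borel G).
Proof.
move=> ch; apply: borel_measurableP => U oU; apply: sub_sigma_algebra.
by move/continuousP : ch; apply.
Qed.

Context (cptG : compact [set: G]).

Lemma continuous_bounded f : continuous f -> exists c : R, forall x, `|f x| <= c.
Proof.
move=> cf; have /compact_near_coveringP cov := cptG.
(* Compactness in its near-covering form: what holds near each point for all large [c] holds on all
   of [G] for all large [c]. *)
have : \forall c \near +oo, [set: G] `<=` (fun x => `|f x| <= c).
  apply: cov => x _.
  exists ([set x' | `|f x - f x'| < 1], [set c | `|f x| + 1 <= c]).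
    split => /=; last exact: nbhs_pinfty_ge.
    by have /cvgrPdist_lt/(_ _ ltr01) := cf x.
  move=> [x' c] [/= fx' fc].
  rewrite (le_trans _ fc)// -lerBlDl (le_trans (lerB_dist _ _))// distrC.
  exact: ltW.
move=> [M [_ HM]]; exists (M + 1) => x; apply: (HM (M + 1)) => //.
by rewrite ltrDl.
Qed.

Lemma continuous_bounded_measurable f : continuous f ->
  bounded_measurable (f : borel G -> R).
Proof.
by move=> cf; split; [exact: continuous_borel_measurable|exact: continuous_bounded].
Qed.

(** The function [F] of [(a, b, u)] is continuous and vanishes at [u = 1]; compactness of [G * G]
    makes the neighbourhood of [1] independent of [a] and [b]. Placing [u] in the middle covers left
    and right uniform continuity at once. *)
Lemma uniform_continuity f (e : R) : continuous f -> 0 < e ->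
  \forall u \near (1%g : G), forall a b, `|f (a * u * b)%g - f (a * b)%g| < e.
Proof.
move=> cf e0.
have /compact_near_coveringP cov : compact ([set: G] `*` [set: G]).
  exact: compact_setX.
have : \forall u \near (1%g : G), [set: G] `*` [set: G] `<=`
    (fun z => `|f (z.1 * u * z.2)%g - f (z.1 * z.2)%g| < e).
  apply: cov => -[a b] _.
  pose F (w : (G * G) * G) := f (w.1.1 * w.2 * w.1.2)%g - f (w.1.1 * w.1.2)%g.
  have cF : continuous F.
    have c1 : continuous (fun w : (G * G) * G => w.1.1).
      by apply: continuous_comp_fun => z; exact: cvg_fst.
    have c2 : continuous (fun w : (G * G) * G => w.1.2).
      by apply: (@continuous_comp_fun _ _ _ fst snd) => z; [exact: cvg_fst|exact: cvg_snd].
    have c3 : continuous (fun w : (G * G) * G => w.2) by move=> z; exact: cvg_snd.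
    move=> w; apply: cvgB.
      apply: (@continuous_comp_fun _ _ _ (fun w => w.1.1 * w.2 * w.1.2)%g f) => //.
      by apply: continuous_mulg => //; exact: continuous_mulg.
    apply: (@continuous_comp_fun _ _ _ (fun w => w.1.1 * w.1.2)%g f) => //.
    exact: continuous_mulg.
  have /cvgrPdist_lt/(_ _ e0) := cF ((a, b), 1%g).
  by apply: filterS => w; rewrite {1}/F /= mulg1 subrr sub0r normrN.
by apply: filterS => u Hu x y; have := Hu (x, y); exact.
Qed.

End compact_group.

(** * Compact metric groups: nets, measurability of products, separability of C(G) *)

Section metric_group.
Context {R : realType} {G : topologicalGroupType} (d : G -> G -> R).
Context (d_eq0 : forall x y, d x y = 0 <-> x = y).
Context (dC : forall x y, d x y = d y x).
Context (d_triangle : forall x y z, d x z <= d x y + d y z).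
Context (nbhs_d : forall x, nbhs x = filter_from [set e : R | 0 < e]
                             (fun e => [set y | d x y < e])).
Implicit Types (f : G -> R) (x y : G).

Lemma metric_refl x : d x x = 0.
Proof. exact/d_eq0. Qed.

Lemma near_metric x (e : R) : 0 < e -> \forall y \near x, d x y < e.
Proof. by move=> e0; rewrite /prop_near1 nbhs_d; exists e. Qed.

Lemma metric_near x (P : set G) : (\forall y \near x, P y) ->
  exists2 e : R, 0 < e & forall y, d x y < e -> P y.
Proof. by rewrite /prop_near1 nbhs_d => -[e e0 He]; exists e. Qed.

Lemma continuous_metric c : continuous (fun x => d c x).
Proof.
move=> x; apply/cvgrPdist_lt => e e0.
apply: filterS (near_metric x e0) => y dxy.
have h1 := d_triangle c x y; have h2 := d_triangle c y x.
rewrite (dC y x) in h2.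
by rewrite ltr_norml; apply/andP; split; lra.
Qed.

Lemma open_metric_ball c (e : R) : open [set x | d c x < e].
Proof.
have /continuousP := @continuous_metric c.
by move=> /(_ _ (@interval_open _ -oo%O (BLeft e) isT isT)) ; rewrite set_itvE.
Qed.

Lemma metric_ball_measurable c (e : R) : measurable ([set x | d c x < e] : set (borel G)).
Proof. by apply: sub_sigma_algebra; exact: open_metric_ball. Qed.

Context (cptG : compact [set: G]).

Lemma finite_net (e : R) : 0 < e ->
  exists s : seq G, forall x, exists2 c, c \in s & d c x < e.
Proof.
move=> e0; have := cptG; rewrite compact_cover => /(_ G setT (fun c => [set x | d c x < e])).
case=> [c _|x _|D _ cD]; first exact: open_metric_ball.
  by exists x => //=; rewrite metric_refl.
by exists (enum_fset D) => x; have [c Dc dcx] := cD x I; exists c.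
Qed.

(** Measurability of [X] and [Y] separately only controls rectangles. Finite nets of radius
    [1 / (n + 1)] give a countable family of rectangles of balls, and the preimage of an open [U] is
    the union of those whose products stay in [U]. *)
Lemma measurable_mulg d' (T : measurableType d') (X Y : T -> borel G) :
  measurable_fun setT X -> measurable_fun setT Y ->
  measurable_fun setT (fun w => (X w : G) * (Y w : G) : borel G)%g.
Proof.
move=> mX mY; apply: borel_measurableP => U oU.
have ball_inv n : 0 < n.+1%:R^-1 :> R by [].
pose net n := projT1 (cid (finite_net (ball_inv n))).
have netP n x : exists2 c, c \in net n & d c x < n.+1%:R^-1.
  by rewrite /net; case: cid => /= s; exact.
pose B n c := [set x | d c x < n.+1%:R^-1].
pose E n (ab : G * G) := if pselect (forall x y, B n ab.1 x -> B n ab.2 y -> U (x * y)%g)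
  then X @^-1` B n ab.1 `&` Y @^-1` B n ab.2 else set0.
rewrite [X in measurable X](_ : _ =
    \bigcup_n \big[setU/set0]_(ab <- [seq (a, b) | a <- net n, b <- net n]) E n ab).
  apply: bigcupT_measurable => n; apply: bigsetU_measurable => ab _.
  rewrite /E; case: pselect => //= ?; apply: measurableI;
    rewrite -[X in measurable X]setTI.
    by apply: mX => //; exact: metric_ball_measurable.
  by apply: mY => //; exact: metric_ball_measurable.
apply/seteqP; split => [w /= Uw|w [n _]]; last first.
  rewrite -bigcup_seq => -[/= ab abn]; rewrite /E; case: pselect => //= h [hX hY].
  exact: h.
have : \forall z \near (X w : G, Y w : G), U (z.1 * z.2)%g.
  have := mulg_continuous (X w : G, Y w : G).
  by apply => /=; exact: open_nbhs_nbhs.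
move=> [[P Q] [/= /metric_near[a a0 Pa] /metric_near[b b0 Qb]] PQU].
(* With this radius, a net ball containing [X w] lies in the ball of radius [a] about [X w], and
   likewise for [Y w] and [b]. *)
have [n nab] : exists n, n.+1%:R^-1 < Num.min a b / 2 :> R.
  have m0 : 0 < Num.min a b / 2 by rewrite divr_gt0// lt_min a0.
  by have [n _ /(_ n (leqnn n)) ] := near_infty_natSinv_lt (PosNum m0); exists n.
exists n => //; rewrite -bigcup_seq.
have [x sx dx] := netP n (X w); have [y sy dy] := netP n (Y w).
exists (x, y); first by apply/allpairsP; exists (x, y).
rewrite /E; case: pselect => //= h; exfalso; apply: h => x' y' /= Bx' By'; apply: (PQU (x', y')); split => /=.
  apply: Pa; rewrite (le_lt_trans (d_triangle _ x _))// (dC _ x).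
  have : Num.min a b <= a by rewrite ge_min lexx.
  by move: Bx' dx nab; rewrite /B /=; move: n.+1%:R^-1 => q *; lra.
apply: Qb; rewrite (le_lt_trans (d_triangle _ y _))// (dC _ y).
have : Num.min a b <= b by rewrite ge_min lexx orbT.
by move: By' dy nab; rewrite /B /=; move: n.+1%:R^-1 => q *; lra.
Qed.

Lemma metric_uniform_continuity f (e : R) : continuous f -> 0 < e ->
  exists2 r : R, 0 < r & forall x y, d x y < r -> `|f x - f y| < e.
Proof.
move=> cf e0; have /compact_near_coveringP cov := cptG.
have : \forall r \near (0:R)^'+, [set: G] `<=`
    (fun x => forall y, d x y < r -> `|f x - f y| < e).
  apply: cov => x _.
  have /cvgrPdist_lt/(_ (e / 2)) := cf x.
  rewrite divr_gt0// => /(_ isT)/metric_near[r r0 Hr].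
  exists ([set x' | d x x' < r / 2], [set s | s < r / 2]).
    by split => /=; [exact: near_metric (divr_gt0 _ _)|exact: nbhs_right_lt (divr_gt0 _ _)].
  move=> [x' s] /= [dx' sr] y dy.
  have h1 := Hr x' ltac:(lra).
  have h2 : d x y < r by rewrite (le_lt_trans (d_triangle _ x' _))//; lra.
  have {}h2 := Hr y h2.
  move: h1 h2; rewrite !ltr_norml => /andP[? ?] /andP[? ?]; apply/andP; split; lra.
move=> H; near (0:R)^'+ => r; exists r => // x y; apply: (near H r) => //.
Unshelve. all: by end_near. Qed.

(** The [psi n i] with [i] below the size of the net form a partition of unity into bumps about the
    points of the [n]-th net; weighting them by the values of [f] at these points approximates [f].
    Real coefficients are harmless, since convergence of Cesaro means is linear in the function. *)
Lemma countable_approximation : exists psi : nat -> nat -> G -> R,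
  (forall n i, continuous (psi n i)) /\
  forall f (e : R), continuous f -> 0 < e -> exists n m (c : nat -> R),
    forall x, `|f x - \sum_(0 <= i < m) c i * psi n i x| <= e.
Proof.
have ball_inv n : 0 < n.+1%:R^-1 :> R by [].
pose net n := projT1 (cid (finite_net (ball_inv n))).
have netP n x : exists2 c, c \in net n & d c x < n.+1%:R^-1.
  by rewrite /net; case: cid => /= s; exact.
pose bump n i x : R := Num.max 0 (n.+1%:R^-1 - d (nth 1%g (net n) i) x).
pose tot n x := \sum_(0 <= i < size (net n)) bump n i x.
have bump0 n i x : 0 <= bump n i x by rewrite le_max lexx.
have cbump n i : continuous (bump n i).
  move=> x; apply: (@continuous_max _ _ (cst 0) (fun x => n.+1%:R^-1 - d (nth 1%g (net n) i) x)).
    exact: cvg_cst.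
  by apply: cvgB; [exact: cvg_cst|exact: continuous_metric].
have tot0 n x : 0 < tot n x.
  have [c cn dc] := netP n x; rewrite /tot big_mkord.
  have ic : (index c (net n) < size (net n))%N by rewrite index_mem.
  rewrite (bigD1 (Ordinal ic))//= ltr_pwDl//; last by apply: sumr_ge0.
  by rewrite /bump nth_index// lt_max subr_gt0 dc orbT.
have ctot n : continuous (tot n) by exact: continuous_sumr.
exists (fun n i x => bump n i x / tot n x); split.
  move=> n i x; apply: cvgM; first exact: cbump.
  by apply: cvgV; [rewrite gt_eqF|exact: ctot].
move=> f e cf e0.
have [r r0 Hr] := metric_uniform_continuity cf e0.
have [n nr] : exists n, n.+1%:R^-1 < r :> R.
  by have [n _ /(_ n (leqnn n)) ] := near_infty_natSinv_lt (PosNum r0); exists n.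
exists n, (size (net n)), (fun i => f (nth 1%g (net n) i)) => x.
have -> : f x = \sum_(0 <= i < size (net n)) f x * (bump n i x / tot n x).
  by rewrite -mulr_sumr -mulr_suml -/(tot n x) divff ?mulr1// gt_eqF.
rewrite -sumrB (le_trans (ler_norm_sum _ _ _))//.
rewrite (@le_trans _ _ (\sum_(0 <= i < size (net n)) e * (bump n i x / tot n x)))//.
  apply: ler_sum => i _; rewrite -mulrBl normrM.
  have bt : 0 <= bump n i x / tot n x by rewrite divr_ge0// ltW.
  rewrite (ger0_norm bt).
  (* Either the net point is close to [x] and uniform continuity applies, or its bump vanishes at
     [x]. *)
  have [h|h] := ltP (d (nth 1%g (net n) i) x) n.+1%:R^-1.
    by rewrite ler_wpM2r// distrC ltW// Hr// (lt_trans h).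
  suff -> : bump n i x = 0 by rewrite mul0r !mulr0.
  by apply/max_idPl; rewrite subr_le0.
by rewrite -mulr_sumr -mulr_suml -/(tot n x) divff ?mulr1// gt_eqF.
Qed.

End metric_group.

(** * Convolution and Haar measure *)

Section convolution.
Context {R : realType} {G : topologicalGroupType}.
Context (metrizableG : metrizable R G) (cptG : compact [set: G]).
Implicit Types (f h : G -> R) (x y a b u : G) (nu : probability (borel G) R).

Lemma measurable_funMg d (T : measurableType d) (X Y : T -> borel G) :
  measurable_fun setT X -> measurable_fun setT Y ->
  measurable_fun setT (fun w => (X w : G) * (Y w : G) : borel G)%g.
Proof.
by case: metrizableG => dist [d0 dC dt dn] mX mY; exact: (measurable_mulg d0 dC dt dn cptG mX mY).
Qed.

Lemma measurable_mulg_prod d (T : measurableType d) f (X Y : T -> borel G) : continuous f ->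
  measurable_fun setT X -> measurable_fun setT Y ->
  bounded_measurable (fun w => f ((X w : G) * (Y w : G))%g).
Proof.
move=> cf mX mY; apply: (bounded_measurable_comp (measurable_funMg mX mY)).
exact: continuous_bounded_measurable.
Qed.

Lemma continuous_lmul f a : continuous f -> continuous (fun x => f (a * x)%g).
Proof. by move=> cf; apply: (continuous_comp_fun (@continuous_mulgl _ a) cf). Qed.

Lemma continuous_rmul f a : continuous f -> continuous (fun x => f (x * a)%g).
Proof. by move=> cf; apply: (continuous_comp_fun (@continuous_mulgr _ a) cf). Qed.

(** The Markov operator [P] of the walk that multiplies on the right by a [nu]-distributed step. *)
Definition conv nu f : G -> R := fun x => \int[nu]_y f (x * (y : G))%g.

Lemma bounded_measurable_lmul f x : continuous f ->
  bounded_measurable (fun y : borel G => f (x * (y : G))%g).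
Proof.
by move=> cf; apply: continuous_bounded_measurable => //; exact: continuous_lmul.
Qed.

(* With [u] in the middle, the bound for [x] replaced by [x * y] is an instance
   of the same bound, so it survives convolution. *)
Definition modulus f (U : set G) (e : R) :=
  forall a u b, U u -> `|f (a * u * b)%g - f (a * b)%g| <= e.

Lemma conv_modulus nu f U (e : R) : continuous f -> modulus f U e ->
  modulus (conv nu f) U e.
Proof.
move=> cf mf a u b Uu; rewrite /conv.
rewrite -bintB; [|exact: bounded_measurable_lmul|exact: bounded_measurable_lmul].
apply: bint_norm_le => [|y].
  by apply: bounded_measurableB; exact: bounded_measurable_lmul.
by rewrite -!mulgA; have := mf a u (b * y)%g Uu; rewrite -!mulgA.
Qed.

(** The modulus inherited from [f], read with [a = x], [u = x^-1 * y] and [b = 1], is continuity at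
    [x]. *)
Lemma conv_continuous nu f : continuous f -> continuous (conv nu f).
Proof.
move=> cf x; apply/cvgrPdist_le => e e0.
have := uniform_continuity cptG cf e0.
set U := [set u | forall a b, `|f (a * u * b)%g - f (a * b)%g| < e] => nU.
have mU : modulus f U e by move=> a u b Uu; exact/ltW/Uu.
have mc := conv_modulus nu cf mU.
have cx : (fun y => x^-1 * y)%g @ x --> (1 : G)%g.
  by have := @continuous_mulgl _ (x^-1)%g x; rewrite /continuous_at mulVg.
have nxU : \forall y \near x, U (x^-1 * y)%g by exact: (cx U nU).
apply: filterS nxU => y Uy.
rewrite distrC; have := mc x _ 1%g Uy.
by rewrite !mulg1 mulVKg.
Qed.

Lemma conv_le nu f (c : R) x : continuous f -> (forall y, f y <= c) -> conv nu f x <= c.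
Proof.
move=> cf fc; rewrite -[leRHS](bint_cst nu); apply: ler_bint => //.
  exact: bounded_measurable_lmul.
exact: bounded_measurable_cst.
Qed.

Lemma conv_ge nu f (c : R) x : continuous f -> (forall y, c <= f y) -> c <= conv nu f x.
Proof.
move=> cf fc; rewrite -[leLHS](bint_cst nu); apply: ler_bint => //.
  exact: bounded_measurable_cst.
exact: bounded_measurable_lmul.
Qed.

Context (lambda : probability (borel G) R) (haar : normalized_haar lambda).

Lemma haar_lmul f a : continuous f ->
  \int[lambda]_x f (a * (x : G))%g = \int[lambda]_x f x.
Proof.
move=> cf.
have ma : measurable_fun [set: borel G] (fun x : borel G => a * (x : G) : borel G)%g.
  by apply: continuous_borel_map; exact: continuous_mulgl.
have [mf fb] := continuous_bounded_measurable cptG cf.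
have bfa := bounded_measurable_lmul a cf.
rewrite /Rintegral; congr fine.
have -> : (\int[lambda]_x (f x)%:E =
    \int[pushforward lambda (fun x : borel G => a * (x : G) : borel G)%g]_x (f x)%:E)%E.
  (* The preimage of [A] under left translation by [a] is [a^-1 A], so invariance says that the
     pushforward of [lambda] is [lambda]. *)
  apply: eq_measure_integral => A mA _; rewrite /pushforward.
  rewrite -[LHS](haar (a^-1)%g mA); congr (lambda _).
  apply/seteqP; split => [_ [y Ay <-]|y /= Ay] /=; first by rewrite mulVKg.
  by exists (a * y)%g => //; rewrite mulKg.
rewrite integral_pushforward//.
  exact/measurable_EFinP.
rewrite preimage_setT; exact: bounded_measurable_integrable bfa.
Qed.

(** Integrate [f (x^-1 * y)] over both variables. With [y] inside, left invariance gives the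
    integral of [f]; with [x] inside, replacing [x] by [y * x] gives the integral of [f (x^-1)].
    Right invariance then follows by conjugating with inversion. *)
Lemma haar_invg f : continuous f ->
  \int[lambda]_x f ((x : G)^-1)%g = \int[lambda]_x f x.
Proof.
move=> cf.
have minv : measurable_fun [set: borel G] (fun x : borel G => (x : G)^-1 : borel G)%g.
  by apply: continuous_borel_map; exact: invg_continuous.
have bF : bounded_measurable (fun z : borel G * borel G => f ((z.1 : G)^-1 * (z.2 : G))%g).
  apply: (measurable_mulg_prod (X := fun z : borel G * borel G => (z.1 : G)^-1 : borel G)%g) => //.
  exact: (measurableT_comp minv).
have := bounded_fubini lambda lambda bF => /=.
under eq_Rintegral do rewrite haar_lmul//.
rewrite bint_cst => ->.
rewrite -[LHS](bint_cst lambda); apply: eq_Rintegral => x _.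
have cinv : continuous (fun y => f (y^-1 * x)%g).
  apply: (@continuous_comp_fun _ _ _ (fun y => y^-1)%g (fun y => f (y * x)%g)).
    exact: invg_continuous.
  exact: continuous_rmul.
rewrite -(haar_lmul x cinv); apply: eq_Rintegral => y _.
by rewrite invgM mulgVK.
Qed.

Lemma haar_rmul f a : continuous f ->
  \int[lambda]_x f ((x : G) * a)%g = \int[lambda]_x f x.
Proof.
move=> cf; rewrite -[LHS]haar_invg; last exact: continuous_rmul.
have cinv : continuous (fun y => f (y^-1)%g).
  by apply: (continuous_comp_fun _ cf); exact: invg_continuous.
rewrite -[RHS]haar_invg// -(haar_lmul (a^-1)%g cinv).
by apply: eq_Rintegral => x _; rewrite invgM invgK.
Qed.

(** After exchanging the integrals, the inner one over [lambda] is constant by right invariance. *)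
Lemma haar_conv nu f : continuous f ->
  \int[lambda]_x conv nu f x = \int[lambda]_x f x.
Proof.
move=> cf; rewrite /conv.
have bF : bounded_measurable (fun z : borel G * borel G => f ((z.1 : G) * (z.2 : G))%g).
  exact: (measurable_mulg_prod cf measurable_fst measurable_snd).
rewrite (bounded_fubini lambda nu bF) /=.
under eq_Rintegral do rewrite haar_rmul//.
by rewrite bint_cst.
Qed.

End convolution.

(** * Contraction of the convolution operator *)

Section doeblin.
Context {R : realType} {G : topologicalGroupType} (cptG : compact [set: G]).
Context (nu : probability (borel G) R) (S : set G) (suppS : is_support nu S).
Implicit Types (f h : G -> R) (x y : G).

(** Otherwise the complement of [W] would be closed of full measure, hence would contain [S] by
    minimality, and [s] with it. *)
Lemma support_gt0 (W : set G) s : open W -> S s -> W s -> 0 < fine (nu W).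
Proof.
move=> oW Ss Ws; have [_ _ minS] := suppS.
have mW : measurable (W : set (borel G)) by exact: sub_sigma_algebra.
rewrite fine_gt0//; apply/andP; split; last first.
  by rewrite (le_lt_trans (probability_le1 nu mW)) ?ltry.
rewrite lt0e measure_ge0 andbT; apply/eqP => nuW0.
have : S `<=` ~` W.
  apply: minS; first exact: open_closedC.
  by have := probability_setC nu mW; rewrite nuW0 sube0.
by move=> /(_ s Ss).
Qed.

Lemma iter_conv_continuous k f : continuous f -> continuous (iter k (conv nu) f).
Proof. by move=> cf; elim: k => //= k IH; exact: conv_continuous. Qed.

Lemma iter_conv_le k f (c : R) : continuous f -> (forall x, f x <= c) ->
  forall x, iter k (conv nu) f x <= c.
Proof.
move=> cf fc; elim: k => //= k IH x.
by apply: conv_le => //; exact: iter_conv_continuous.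
Qed.

Lemma iter_conv_ge k f (c : R) : continuous f -> (forall x, c <= f x) ->
  forall x, c <= iter k (conv nu) f x.
Proof.
move=> cf fc; elim: k => //= k IH x.
by apply: conv_ge => //; exact: iter_conv_continuous.
Qed.

Lemma power_set_productS k z : power_set_product S k.+1 z ->
  exists s z', [/\ S s, power_set_product S k z' & z = (s * z')%g].
Proof.
move=> [g gS <-]; exists (g ord0), (\prod_(j < k) g (lift ord0 j))%g; split => //.
  by exists (fun j => g (lift ord0 j)).
by rewrite big_ord_recl.
Qed.

(* [delta] is a lower bound for the mass that the [k]-th convolution power of
   [nu] gives to [V]. *)
Lemma minorization k (V : set G) z : open V -> power_set_product S k z -> V z ->
  exists delta : R, [/\ 0 < delta, delta <= 1 &
    forall h (b m : R) x, continuous h -> m <= b -> (forall y, h y <= b) ->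
      (forall y, V y -> h (x * y)%g <= m) ->
      iter k (conv nu) h x <= b - delta * (b - m)].
Proof.
elim: k V z => [|k IH] V z oV.
  move=> [g _ <-]; rewrite big_ord0 => V1; exists 1; split => // h b m x _ _ _ Hm.
  by have := Hm _ V1; rewrite mulg1 /=; lra.
move=> /power_set_productS[s [z' [Ss Sz' ->]]] Vsz.
(* Neighbourhoods [W] of [s] and [V'] of [z'] with [W V'] inside [V]: a first step in [W] followed
   by [k] steps with product in [V'] ends in [V], which explains the constant [delta * nu W]. *)
have : \forall w \near (s, z'), V (w.1 * w.2)%g.
  have := mulg_continuous (s, z').
  by apply; exact: open_nbhs_nbhs.
move=> [[P Q] [/= Ps Qz'] PQV].
rewrite nbhsE in Ps; rewrite nbhsE in Qz'.
move: Ps Qz' => [W [oW Ws] WP] [V' [oV' V'z'] V'Q].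
have [delta [d0 d1 Hd]] := IH V' z' oV' Sz' V'z'.
have nuW := support_gt0 oW Ss Ws.
have mW : measurable (W : set (borel G)) by exact: sub_sigma_algebra.
have nuW1 : fine (nu W) <= 1.
  by rewrite -lee_fin fineK ?probability_le1// fin_num_measure.
exists (delta * fine (nu W)); split; first exact: mulr_gt0.
  by rewrite mulr_ile1// ltW.
move=> h b m x ch mb hb hm /=.
have cH := @iter_conv_continuous k h ch.
have bW := bounded_measurable_indic mW (R := R).
(* The bound becomes the integral over the first step [y] of a pointwise bound: the induction
   hypothesis at [x * y] when [y] lies in [W], and [b] elsewhere. *)
have -> : b - delta * fine (nu W) * (b - m) =
    \int[nu]_y (b - (delta * (b - m)) * \1_W y).
  rewrite bintB; [|exact: bounded_measurable_cst|exact: bounded_measurableZ].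
  by rewrite bint_cst bintZ// bint_indic// mulrAC.
apply: ler_bint => [||y].
- exact: bounded_measurable_lmul.
- by apply: bounded_measurableB; [exact: bounded_measurable_cst|exact: bounded_measurableZ].
- rewrite indicE; case: (boolP (y \in W)) => [/set_mem Wy|_].
    rewrite mulr1; apply: Hd => // y' Vy'; rewrite -mulgA; apply: hm.
    by apply: (PQV (y, y')); split => /=; [exact: WP|exact: V'Q].
  by rewrite mulr0 subr0; exact: iter_conv_le.
Qed.

Definition avg_conv (s : seq nat) h : G -> R :=
  fun x => (size s)%:R^-1 * \sum_(k <- s) iter k (conv nu) h x.

(** Inductive, so that continuity, the common modulus, the Haar integral and the Cesaro means along
    the walk all pass from [f] to its averages by induction. *)
Inductive averages_of f : (G -> R) -> Prop :=
| averages_refl : averages_of f f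
| averages_step s h : s != [::] -> averages_of f h -> averages_of f (avg_conv s h).

Lemma avg_conv_continuous s f : continuous f -> continuous (avg_conv s f).
Proof.
move=> cf x; apply: cvgM; first exact: cvg_cst.
by apply: continuous_sumr => k; exact: iter_conv_continuous.
Qed.

Lemma iter_conv_modulus k f (U : set G) (e : R) : continuous f ->
  modulus f U e -> modulus (iter k (conv nu) f) U e.
Proof.
move=> cf mf; elim: k => //= k IH.
by apply: conv_modulus => //; exact: iter_conv_continuous.
Qed.

Lemma mean_seq_const (s : seq nat) (c : R) : s != [::] ->
  (size s)%:R^-1 * \sum_(k <- s) c = c.
Proof.
move=> s0; rewrite big_const_seq count_predT iter_addr addr0 -(mulr_natl c) mulKf//.
by rewrite pnatr_eq0 size_eq0.
Qed.

Lemma avg_conv_modulus s f (U : set G) (e : R) : s != [::] -> continuous f ->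
  modulus f U e -> modulus (avg_conv s f) U e.
Proof.
move=> s0 cf mf a u b Uu; rewrite /avg_conv -mulrBr -sumrB normrM.
rewrite ger0_norm ?invr_ge0//.
rewrite -[leRHS](@mean_seq_const s)// ler_wpM2l ?invr_ge0//.
rewrite (le_trans (ler_norm_sum _ _ _))//; apply: ler_sum => k _.
exact: (iter_conv_modulus k cf mf).
Qed.

Lemma averages_continuous f h : continuous f -> averages_of f h -> continuous h.
Proof. by move=> cf; elim => // s h' _ _; exact: avg_conv_continuous. Qed.

Lemma averages_modulus f h (U : set G) (e : R) : continuous f -> modulus f U e ->
  averages_of f h -> modulus h U e.
Proof.
move=> cf mf; elim => // s h' s0 ah'; apply: avg_conv_modulus => //.
exact: averages_continuous ah'.
Qed.

Lemma positive_lower_bound (I : eqType) (s : seq I) (F : I -> R) :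
  (forall i, 0 < F i) -> exists2 c : R, 0 < c & forall i, i \in s -> c <= F i.
Proof.
move=> F0; elim: s => [|i s [c c0 Hc]]; first by exists 1.
exists (Num.min (F i) c); first by rewrite lt_min F0.
move=> j; rewrite inE => /predU1P[->|js]; first by rewrite ge_min lexx.
by rewrite ge_min Hc ?orbT.
Qed.

Context (denseS : closure (\bigcup_(n in [set n | (0 < n)%N]) power_set_product S n) = [set: G]).

(** Cover [G] by finitely many open [V c], each charged by some power of [nu] and so small that [h]
    varies by at most [e] on every [x V c]. From any [x] one of these sets leads near a low value of
    [h]. Both [s] and [delta] are chosen before [h], so the step can be iterated with the same
    gain. *)
Lemma contraction (U : set G) (e : R) : nbhs (1 : G)%g U -> 0 < e ->
  exists s (delta : R), [/\ s != [::], 0 < delta &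
    forall h (a b : R), continuous h -> modulus h U e ->
      (forall x, a <= h x <= b) -> 3 * e < b - a ->
      exists a' b', (forall x, a' <= avg_conv s h x <= b') /\ b' - a' <= b - a - delta].
Proof.
move=> nU e0.
have HV c : exists V : set G, [/\ open V, V c & forall y z, V y -> V z -> U (y * z^-1)%g].
  have : \forall w \near (c, c), U (w.1 * w.2^-1)%g.
    have cF : continuous (fun w : G * G => w.1 * w.2^-1)%g.
      have cfst : continuous (fst : G * G -> G) by move=> w; exact: cvg_fst.
      have csnd : continuous (snd : G * G -> G) by move=> w; exact: cvg_snd.
      exact: (continuous_mulg cfst (continuous_comp_fun csnd (@invg_continuous G))).
    by have := cF (c, c); apply; rewrite /= mulgV.
  move=> [[P Q] [/= Pc Qc] PQU].
  have : nbhs c (P `&` Q) by exact: filterI.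
  rewrite nbhsE => -[V [oV Vc] VPQ].
  exists V; split => // y z /VPQ[Py _] /VPQ[_ Qz].
  by apply: (PQU (y, z)).
pose V c := projT1 (cid (HV c)).
have VP c : [/\ open (V c), V c c & forall y z, V c y -> V c z -> U (y * z^-1)%g].
  by rewrite /V; case: cid.
have Hk c : exists kd : nat * R, [/\ 0 < kd.2, kd.2 <= 1 &
    forall h (b m : R) x, continuous h -> m <= b -> (forall y, h y <= b) ->
      (forall y, V c y -> h (x * y)%g <= m) ->
      iter kd.1 (conv nu) h x <= b - kd.2 * (b - m)].
  have [oV Vc _] := VP c.
  have : closure (\bigcup_(n in [set n | (0 < n)%N]) power_set_product S n) c.
    by rewrite denseS.
  move=> /(_ (V c)) []; first exact: open_nbhs_nbhs.
  move=> z [[k _ Sz] Vz].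
  by have [delta H] := minorization oV Sz Vz; exists (k, delta).
pose kd c := projT1 (cid (Hk c)).
have kdP c := projT2 (cid (Hk c)).
have := cptG; rewrite compact_cover => /(_ G setT V).
case=> [c _|x _|D _ cD]; first by have [] := VP c.
  by exists x => //; have [] := VP x.
have [delta d0 Hdelta] := @positive_lower_bound _ (enum_fset D) (fun c => (kd c).2)
  (fun c => let: And3 h _ _ := kdP c in h).
pose n := size (enum_fset D).
have n0 : (0 < n)%N.
  have [c Dc _] := cD 1%g I; rewrite lt0n; apply/negP => /eqP/size0nil D0.
  have : c \in enum_fset D by exact: Dc.
  by rewrite D0.
have n0R : 0 < n%:R :> R by rewrite ltr0n.
(* The first bound is the gain when [h] takes a value below its midrange; the second serves the
   other case, where the gain is [(b - a) / 2 > e]. *)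
have [dl [dl0 dln dle]] : exists dl : R,
    [/\ 0 < dl, dl <= n%:R^-1 * (delta * (e / 2)) & dl <= e].
  exists (Num.min (n%:R^-1 * (delta * (e / 2))) e).
  rewrite !ge_min !lexx orbT lt_min e0 andbT; split => //.
  by rewrite mulr_gt0 ?invr_gt0// mulr_gt0// divr_gt0.
exists [seq (kd c).1 | c <- enum_fset D], dl.
split => //; first by rewrite -size_eq0 size_map -lt0n.
move=> h a b ch mh hab w3.
have ha x : a <= h x by have /andP[] := hab x.
have hb x : h x <= b by have /andP[] := hab x.
set s := [seq _ | c <- _].
have s0 : s != [::] by rewrite -size_eq0 size_map -lt0n.
have Ahb x : avg_conv s h x <= b.
  rewrite -[leRHS](@mean_seq_const s)// ler_wpM2l ?invr_ge0//.
  by apply: ler_sum => k _; exact: iter_conv_le.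
have Aha (a' : R) : (forall x, a' <= h x) -> forall x, a' <= avg_conv s h x.
  move=> ha' x; rewrite -[leLHS](@mean_seq_const s)// ler_wpM2l ?invr_ge0//.
  by apply: ler_sum => k _; exact: iter_conv_ge.
(* If [h] stays above its midrange, the midrange is a better lower bound;
   otherwise averaging mixes a low value of [h] into every point. *)
have [[p hp]|np] := pselect (exists p, h p <= (a + b) / 2); last first.
  exists ((a + b) / 2), b; split.
    move=> x; rewrite Ahb andbT; apply: Aha => y.
    by rewrite leNgt; apply/negP => hy; apply: np; exists y; exact: ltW.
  by lra.
exists a, (b - n%:R^-1 * (delta * (e / 2))); split; last first.
  by rewrite addrAC lerD2l lerN2.
move=> x; rewrite Aha//=.
have [c Dc Vxp] := cD (x^-1 * p)%g I.
have [_ _ HU] := VP c.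
have [_ kd1 Hkd] := kdP c.
have Hc : iter (kd c).1 (conv nu) h x <= b - delta * (e / 2).
  (* Minorization with the level [m = (a + b) / 2 + e]; since [b - a > 3 * e], the gap [b - m]
     exceeds [e / 2]. *)
  apply: (@le_trans _ _ (b - (kd c).2 * (b - ((a + b) / 2 + e)))).
    apply: Hkd => //; first by lra.
    (* The modulus compares [h (x * y)] with [h p], because [x * (x^-1 * p) = p]. *)
    move=> y Vy; have := mh x (y * (x^-1 * p)^-1)%g (x^-1 * p)%g (HU _ _ Vy Vxp).
    rewrite mulVKg -mulgA mulgVK ler_norml => /andP[_].
    by lra.
  rewrite lerD2l lerN2; apply: ler_pM.
  - exact: ltW.
  - by rewrite ltW// divr_gt0.
  - exact: Hdelta.
  - by lra.
(* The term of [c] carries the gain and the other [n - 1] iterates are at most [b], so the average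
   gains one [n]-th of it. *)
rewrite /avg_conv /s big_map size_map -/n (big_rem c)//=.
rewrite (_ : b - _ = n%:R^-1 * (b - delta * (e / 2) + (n.-1)%:R * b)).
  rewrite ler_wpM2l ?invr_ge0// lerD//.
  rewrite (@le_trans _ _ (\sum_(y <- rem c (enum_fset D)) b))//.
    by apply: ler_sum => k _; exact: iter_conv_le.
  by rewrite big_const_seq count_predT iter_addr addr0 size_rem// -(mulr_natl b).
have -> : (n.-1)%:R = n%:R - 1 :> R by rewrite -subn1 natrB.
by field; rewrite gt_eqF.
Qed.

(** All averages of [f] share one modulus at level [e / 3], so each contraction narrows the range by
    the same [delta] while it is wider than [e]; finitely many steps suffice. *)
Lemma averages_almost_constant f (e : R) : continuous f -> 0 < e ->
  exists h (a : R), averages_of f h /\ forall x, `|h x - a| <= e.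
Proof.
move=> cf e0; have e30 : 0 < e / 3 by rewrite divr_gt0.
have nU := uniform_continuity cptG cf e30.
set U := [set u | forall a b, `|f (a * u * b)%g - f (a * b)%g| < e / 3] in nU.
have mU : modulus f U (e / 3) by move=> a u b Uu; exact/ltW/Uu.
have [s [delta [s0 d0 step]]] := contraction nU e30.
have [c fc] := continuous_bounded cptG cf.
(* Induction on the number [n] of steps of size [delta] that cover the excess of the width over
   [e]. *)
have shrink n : forall h (a b : R), averages_of f h -> (forall x, a <= h x <= b) ->
    b - a <= e + n%:R * delta ->
  exists h' (a' b' : R), [/\ averages_of f h', forall x, a' <= h' x <= b' & b' - a' <= e].
  elim: n => [|n IH] h a b ah hab w; first by exists h, a, b; split => //; lra.
  have [|we] := leP (b - a) e; first by exists h, a, b.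
  have [a' [b' [hab' w']]] := step h a b (averages_continuous cf ah)
    (averages_modulus cf mU ah) hab ltac:(lra).
  apply: (IH (avg_conv s h) a' b') => //; first exact: averages_step.
  by move: w w'; rewrite -natr1 mulrDl; lra.
have [n Hn] : exists n, (c - - c) / delta < n%:R.
  by exists (Num.truncn ((c - - c) / delta)).+1; exact: truncnS_gt.
have [||h [a [b [ah hab w]]]] := shrink n f (- c) c (averages_refl f).
- by move=> x; rewrite -ler_norml.
- by move: Hn; rewrite ltr_pdivrMr//; lra.
exists h, a; split => // x; have /andP[? ?] := hab x.
by rewrite ler_norml; apply/andP; split; lra.
Qed.

End doeblin.

(** * Cesaro means and a law of large numbers *)

Section cesaro.
Context {R : realType}.
Implicit Types a : nat -> R.

Definition cesaro a (N : nat) : R := N%:R^-1 * \sum_(0 <= k < N) a k.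

Lemma sum_bound a (c : R) m n : (forall k, `|a k| <= c) -> (m <= n)%N ->
  `|\sum_(0 <= k < n) a k| <= `|\sum_(0 <= k < m) a k| + c * (n - m)%:R.
Proof.
move=> ac mn; rewrite (big_cat_nat (leq0n m) mn)/= (le_trans (ler_normD _ _))// lerD2l.
rewrite (le_trans (ler_norm_sum _ _ _))//.
rewrite (le_trans (ler_sum _ (fun k _ => ac k)))// big_const_nat iter_addr addr0.
by rewrite -(mulr_natr c).
Qed.

Lemma nat_sqrt_exists N : (0 < N)%N ->
  exists m, (m.+1 ^ 2 <= N)%N /\ (N < m.+2 ^ 2)%N.
Proof.
elim: N => // -[|N] IH _; first by exists 0%N.
have [//|m [mN Nm]] := IH.
have [h|h] := leqP (m.+2 ^ 2) N.+2; last by exists m; split => //; exact: leq_trans mN _.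
by exists m.+1; split => //; nia.
Qed.

Lemma cesaro_norm a N : `|cesaro a N| = N%:R^-1 * `|\sum_(0 <= k < N) a k|.
Proof. by rewrite normrM normfV normr_nat. Qed.

(** For [N] between [(m + 1)^2] and [(m + 2)^2] the two partial sums differ by a number of terms
    linear in [m], negligible against [N] for bounded [a]. *)
Lemma cesaro_subseq a (c : R) : (forall k, `|a k| <= c) ->
  (fun m => cesaro a (m.+1 ^ 2)) @ \oo --> (0 : R) -> cesaro a @ \oo --> (0 : R).
Proof.
move=> ac /cvgrPdist_le H; apply/cvgrPdist_le => e e0.
have c0 : 0 <= c by exact: le_trans (normr_ge0 _) (ac 0%N).
have e20 : 0 < e / 2 by rewrite divr_gt0.
have [M _ HM] := H _ e20.
(* The gap has at most [5 * (m + 1)] terms, and [5 * c * (m + 1) <= (m + 1)^2 * e / 2] as soon as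
   [m + 1 >= 10 * c / e]. The threshold on [N] below forces [m] to be at least [M] and [K]. *)
pose K := (Num.truncn (10 * c / e)).+1.
have HK : 10 * c / e < K%:R by exact: truncnS_gt.
exists ((maxn M K).+2 ^ 2)%N => // N /= MN.
have N0 : (0 < N)%N by apply: leq_trans MN; rewrite expn_gt0.
have [m [mN Nm]] := nat_sqrt_exists N0.
have mMK : (maxn M K <= m)%N.
  have : ((maxn M K).+2 ^ 2 < m.+2 ^ 2)%N by exact: leq_ltn_trans MN Nm.
  by rewrite ltn_exp2r// !ltnS => /ltnW.
have := HM m (leq_trans (leq_maxl M K) mMK).
have Km := leq_trans (leq_maxr M K) mMK.
have N0R : 0 < N%:R :> R by rewrite ltr0n.
have m0R : 0 < (m.+1 ^ 2)%:R :> R by rewrite ltr0n expn_gt0.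
rewrite !sub0r !normrN !cesaro_norm.
rewrite !ler_pdivrMl// => Hm.
apply: (le_trans (sum_bound ac mN)).
rewrite (@le_trans _ _ (N%:R * (e / 2) + N%:R * (e / 2)))//; last first.
  by rewrite -mulrDr -splitr.
apply: lerD; first by rewrite (le_trans Hm)// ler_wpM2r ?ler_nat// ltW.
have h1 : ((N - m.+1 ^ 2) <= 5 * m.+1)%N by lia.
have h2 : c * (N - m.+1 ^ 2)%:R <= c * (5 * m.+1)%:R by rewrite ler_wpM2l// ler_nat.
apply: (le_trans h2).
have h3 : 10 * c <= e * m.+1%:R.
  rewrite -ler_pdivrMl// mulrC (le_trans (ltW HK))// ler_nat.
  exact: leqW.
have h4 : (m.+1 ^ 2)%:R <= N%:R :> R by rewrite ler_nat.
apply: (@le_trans _ _ ((m.+1 ^ 2)%:R * (e / 2))); last by rewrite ler_wpM2r// ltW.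
have m1 : 0 <= m.+1%:R :> R by [].
move: h3; rewrite natrX natrM; move: (m.+1%:R) m1 => q q0 h3.
have := ler_wpM2r q0 h3; rewrite expr2; nra.
Qed.

Lemma cesaroD a b : cesaro (fun k => a k + b k) = (fun N => cesaro a N + cesaro b N).
Proof. by apply/funext => N; rewrite /cesaro big_split mulrDr. Qed.

Lemma cvg_cesaroD a b e : (forall k, e k = a k + b k) ->
  cesaro a @ \oo --> (0 : R) -> cesaro b @ \oo --> (0 : R) ->
  cesaro e @ \oo --> (0 : R).
Proof.
move=> eab ca cb; rewrite (_ : e = fun k => a k + b k); last exact/funext.
by rewrite cesaroD -[X in _ --> X]addr0; exact: cvgD.
Qed.

Lemma cesaroB a b : cesaro (fun k => a k - b k) = (fun N => cesaro a N - cesaro b N).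
Proof. by apply/funext => N; rewrite /cesaro sumrB mulrBr. Qed.

(** The sum telescopes to [a 0 - a N], of size at most [2 * c]. *)
Lemma cvg_cesaro_shift a (c : R) : (forall k, `|a k| <= c) ->
  cesaro (fun k => a k - a k.+1) @ \oo --> (0 : R).
Proof.
move=> ac; have c0 : 0 <= c by exact: le_trans (normr_ge0 _) (ac 0%N).
apply/cvgrPdist_le => e e0.
pose K := (Num.truncn (2 * c / e)).+1.
have HK : 2 * c / e < K%:R by exact: truncnS_gt.
exists K => // N /= KN.
have N0 : 0 < N%:R :> R by rewrite ltr0n (leq_trans _ KN).
rewrite sub0r normrN cesaro_norm.
under eq_bigr do rewrite -opprB.
rewrite sumrN telescope_sumr// opprB ler_pdivrMl//.
rewrite (le_trans (ler_normB _ _))// (le_trans (lerD (ac _) (ac _)))//.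
have KNR : K%:R <= N%:R :> R by rewrite ler_nat.
have : 2 * c / e <= N%:R by rewrite ltW// (lt_le_trans HK).
by rewrite ler_pdivrMr//; lra.
Qed.

Lemma cvg_sum0 (s : seq nat) (u : nat -> nat -> R) :
  (forall k, u k @ \oo --> (0 : R)) ->
  (fun N => \sum_(k <- s) u k N) @ \oo --> (0 : R).
Proof.
move=> u0; elim: s => [|k s IH].
  rewrite (_ : (fun N => _) = cst (0 : R)); first exact: cvg_cst.
  by apply/funext => N; rewrite big_nil.
rewrite (_ : (fun N => _) = u k \+ (fun N => \sum_(k <- s) u k N)).
  by rewrite -[X in _ --> X]addr0; exact: cvgD.
by apply/funext => N; rewrite big_cons.
Qed.

Lemma sum_inv_squares n : \sum_(0 <= m < n) (m.+1%:R ^+ 2)^-1 <= 2 :> R.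
Proof.
(* The sharper bound carries the induction, through [1 / (q + 1) + 1 / (q + 1)^2 <= 1 / q]. *)
suff : \sum_(0 <= m < n.+1) (m.+1%:R ^+ 2)^-1 <= 2 - n.+1%:R^-1 :> R.
  move=> H; rewrite big_nat_recr//= in H.
  have : 0 <= (n.+1%:R ^+ 2)^-1 :> R by rewrite invr_ge0 exprn_ge0.
  have : 0 <= n.+1%:R^-1 :> R by rewrite invr_ge0.
  by move: H; move: (_^-1) (_^-1) => p q; lra.
elim: n => [|n IH]; first by rewrite big_nat1 expr1n invr1; lra.
rewrite big_nat_recr//= -[n.+2%:R]natr1.
apply: (le_trans (lerD IH (lexx _))).
have q0 : 0 < n.+1%:R :> R by rewrite ltr0n.
move: (n.+1%:R) q0 => q q0.
have h : (q + 1)^-1 + ((q + 1) ^+ 2)^-1 <= q^-1.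
  rewrite -subr_ge0 (_ : _ - _ = (q * (q + 1) ^+ 2)^-1).
    by rewrite invr_ge0 mulr_ge0 ?exprn_ge0//; lra.
  by field; apply/andP; split; lra.
by lra.
Qed.

End cesaro.

(** * A strong law of large numbers for bounded orthogonal variables *)

Section orthogonal_lln.
Context {R : realType} {d : measure_display} {T : measurableType d}.
Context (P : probability T R) (D : nat -> T -> R) (c : R).
Context (mD : forall k, bounded_measurable (D k)) (Dc : forall k x, `|D k x| <= c).
Context (orthD : forall j k, (j < k)%N -> \int[P]_x (D j x * D k x) = 0).

Let sums n x := \sum_(0 <= k < n) D k x.

Let bm_sums n : bounded_measurable (sums n).
Proof. exact: bounded_measurable_sum. Qed.

(** Each new term is orthogonal to the preceding sum, so only its own square, at most [c ^+ 2], is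
    added. *)
Lemma orthogonal_sum_square n : \int[P]_x (sums n x * sums n x) <= n%:R * c ^+ 2.
Proof.
elim: n => [|n IH].
  under eq_Rintegral do rewrite /sums big_geq// mul0r.
  by rewrite bint_cst mul0r.
have -> : \int[P]_x (sums n.+1 x * sums n.+1 x) =
    \int[P]_x ((sums n x * sums n x + 2 * (sums n x * D n x)) + D n x * D n x).
  by apply: eq_Rintegral => x _; rewrite /sums big_nat_recr//=; ring.
have b1 := bounded_measurableM (bm_sums n) (bm_sums n).
have b2 := bounded_measurableM (bm_sums n) (mD n).
have b3 := bounded_measurableM (mD n) (mD n).
rewrite bintD//; last by apply: bounded_measurableD => //; exact: bounded_measurableZ.
rewrite bintD//; last exact: bounded_measurableZ.
rewrite bintZ// (_ : \int[P]_x (sums n x * D n x) = 0) ?mulr0 ?addr0; last first.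
  transitivity (\int[P]_x (\sum_(0 <= k < n) D k x * D n x)).
    by apply: eq_Rintegral => x _; rewrite /sums mulr_suml.
  rewrite bint_sum => [|k]; last exact: bounded_measurableM.
  by rewrite big_nat big1// => k kn; exact: orthD.
rewrite -natr1 mulrDl mul1r; apply: lerD => //.
rewrite -[leRHS](bint_cst P); apply: ler_bint => // [|x].
  exact: bounded_measurable_cst.
by rewrite -expr2 -real_normK ?num_real// ler_pXn2r ?nnegrE// (le_trans _ (Dc n x)).
Qed.

Lemma orthogonal_lln : {ae P, forall x, cesaro (D ^~ x) @ \oo --> (0 : R)}.
Proof.
(* The second moments are summable along the squares only, and
   [cesaro_subseq] fills the gaps. *)
pose V m x := (cesaro (D ^~ x) (m.+1 ^ 2)) ^+ 2.
have V0 m x : 0 <= V m x by exact: sqr_ge0.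
have VE m : V m = fun x => ((m.+1 ^ 2)%:R ^+ 2)^-1 * (sums (m.+1 ^ 2) x * sums (m.+1 ^ 2) x).
  by apply/funext => x; rewrite /V /cesaro exprMn exprVn -expr2.
have bV m : bounded_measurable (V m).
  by rewrite VE; apply: bounded_measurableZ; exact: bounded_measurableM.
have intV m : \int[P]_x V m x <= c ^+ 2 * (m.+1%:R ^+ 2)^-1.
  rewrite VE bintZ; last exact: bounded_measurableM.
  have i0 : 0 <= ((m.+1 ^ 2)%:R ^+ 2)^-1 :> R by rewrite invr_ge0 sqr_ge0.
  apply: (le_trans (ler_wpM2l i0 (orthogonal_sum_square _))).
  have q0 : 0 < m.+1%:R :> R by rewrite ltr0n.
  rewrite !natrX; move: (m.+1%:R) q0 => q q0.
  by rewrite le_eqVlt; apply/orP; left; apply/eqP; field; rewrite gt_eqF.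
have mEV m : measurable_fun setT (EFin \o V m).
  by apply/measurable_EFinP; have [] := bV m.
(* The series of the [V m] has finite integral, so it converges almost everywhere and its terms tend
   to 0 there. *)
have fin : (\int[P]_x (\sum_(m <oo) (V m x)%:E) < +oo)%E.
  rewrite integral_nneseries//; last by move=> m x _; rewrite lee_fin.
  apply: (@le_lt_trans _ _ (c ^+ 2 * 2)%:E); last by rewrite ltry.
  apply: lime_le.
    by apply: is_cvg_nneseries => m _ _; apply: integral_ge0 => x _; rewrite lee_fin.
  apply: nearW => n.
  have -> : (\sum_(0 <= m < n) \int[P]_x (V m x)%:E =
      (\sum_(0 <= m < n) \int[P]_x V m x)%:E)%E.
    by rewrite -sumEFin; apply: eq_bigr => m _; rewrite bint_EFin.
  rewrite lee_fin (le_trans (ler_sum _ (fun m _ => intV m)))// -mulr_sumr.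
  by rewrite ler_wpM2l ?sqr_ge0// sum_inv_squares.
have iV : P.-integrable setT (fun x => \sum_(m <oo) (V m x)%:E)%E.
  apply/integrableP; split.
    apply: (@ge0_emeasurable_sum _ _ _ _ (fun m x => (V m x)%:E) xpredT) => [m x _ _|m _].
      by rewrite lee_fin.
    exact: mEV.
  apply: le_lt_trans fin; rewrite le_eqVlt; apply/orP; left; apply/eqP.
  by apply: eq_integral => x _; rewrite gee0_abs//; apply: nneseries_ge0 => m _ _;
    rewrite lee_fin.
have := integrable_ae measurableT iV; apply: filterS => x /(_ I) Vfin.
apply: (@cesaro_subseq _ _ c) => //.
have cvgV : V ^~ x @ \oo --> (0 : R).
  apply: cvg_series_cvg_0; apply: nnseries_is_cvg => //.
  by rewrite -ge0_fin_numE// nneseries_ge0// => m _ _; rewrite lee_fin.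
apply/cvgrPdist_lt => e e0.
have e20 : 0 < e ^+ 2 by rewrite exprn_gt0.
have /cvgrPdist_lt/(_ _ e20) := cvgV.
apply: filterS => m; rewrite !sub0r !normrN /V normrX.
by rewrite ltr_pXn2r ?nnegrE// ltW.
Qed.

End orthogonal_lln.

(** * Independence of the past *)

Section past.
Context {R : realType} {d d' : measure_display} {Omega : measurableType d}
  {T : measurableType d'} (P : probability Omega R) (xi : nat -> {RV P >-> T}).
Context (nu : probability T R) (xi_iid : iid_with_law xi nu).

(** A generating family stable under intersection, on which equality of two finite measures can be
    tested. *)
Definition cylinders (k : nat) : set (set Omega) :=
  [set E | exists2 A : nat -> set T, (forall i, measurable (A i)) &
     E = \bigcap_(i in `I_k) (xi i @^-1` A i)].

(* [Omega] equipped with the sigma-algebra generated by [xi 0, ..., xi (k - 1)]. *)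
Definition past (k : nat) := g_sigma_algebraType (cylinders k).

Lemma preimage_xi_measurable i (A : set T) : measurable A ->
  measurable (xi i @^-1` A).
Proof. by move=> mA; rewrite -[X in measurable X]setTI; exact: measurable_funPT. Qed.

Lemma cylinders_measurable k : cylinders k `<=` measurable.
Proof.
by move=> _ [A mA ->]; apply: bigcap_measurableType => i _; exact: preimage_xi_measurable.
Qed.

Lemma iid_cylinder n (A : nat -> set T) : (forall i, measurable (A i)) ->
  P (\bigcap_(i in `I_n) (xi i @^-1` A i)) = (\prod_(0 <= i < n) nu (A i))%E.
Proof.
move=> mA; have [ind law] := xi_iid.
pose J := [fset i in iota 0 n]%fset.
have JE : [set` J] = `I_n.
  by apply/seteqP; split => i /=; rewrite /J in_fset /= mem_iota add0n.
rewrite -JE ind// (perm_big (iota 0 n)); last first.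
  apply: uniq_perm; [exact: fset_uniq|exact: iota_uniq|].
  by move=> i; rewrite /J in_fset.
rewrite /index_iota subn0; apply: eq_bigr => i _.
exact: (law i _ (mA i)).
Qed.

(** The identity as a measurable map onto the coarser space; its law is [P] restricted to the
    past. *)
Definition to_past (k : nat) : Omega -> past k := id.

Lemma measurable_to_past k : measurable_fun [set: Omega] (@to_past k).
Proof.
apply: (@measurability _ _ _ _ setT (@to_past k) (cylinders k)) => // _ [E cE <-].
by rewrite setTI; exact: (cylinders_measurable cE).
Qed.

HB.instance Definition _ (k : nat) :=
  isMeasurableFun.Build _ _ _ _ (@to_past k) (@measurable_to_past k).

Lemma measurable_xi_past k i : (i < k)%N -> measurable_fun [set: past k] (xi i : past k -> T).
Proof.
move=> ik _ A mA; rewrite setTI; apply: sub_sigma_algebra.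
exists (fun j => if j == i then A else setT) => [j|]; first by case: ifP.
apply/seteqP; split => [w /= Aw j /= _|w /= /(_ i ik)]; last by rewrite /= eqxx.
by case: ifPn => // /eqP ->.
Qed.

(** As functions of [E] both sides are finite measures, and independence makes them agree on
    cylinders; uniqueness of measures extends this to the generated sigma-algebra. *)
Lemma past_independent k (E : set Omega) (B : set T) :
  (cylinders k).-sigma.-measurable E -> measurable B ->
  P (E `&` xi k @^-1` B) = (P E * nu B)%E.
Proof.
move=> mE mB; have mxB := preimage_xi_measurable k mB.
have nuB_fin : (nu B \is a fin_num)%E by exact: fin_num_measure.
have nuB0 : 0 <= fine (nu B) by exact: fine_ge0.
have cylT : cylinders k setT.
  exists (fun=> setT) => //; apply/seteqP; split => // w _ i _; exact: I.
have scaleE X : mscale (NngNum nuB0) P X = (P X * nu B)%E.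
  by rewrite /mscale /= fineK// muleC.
suff : mrestr P mxB E = mscale (NngNum nuB0) P E by rewrite scaleE.
apply: (g_sigma_algebra_measure_unique (cylinders k) (@cylinders_measurable k)
  (fun=> setT)) => //.
- by apply/seteqP; split => // w _; exists 0%N.
- move=> _ _ [A mA ->] [A' mA' ->]; exists (fun i => A i `&` A' i).
    by move=> i; exact: measurableI.
  by rewrite -bigcapI; apply: eq_bigcapr => i _; rewrite preimage_setI.
- move=> _ [A mA ->]; apply: (etrans _ (esym (scaleE _))).
  rewrite -[LHS]/(P (_ `&` xi k @^-1` B)) iid_cylinder//.
  (* Intersecting with the event on [xi k] gives a cylinder of length [k + 1] whose last side is
     [B]. *)
  pose A' i := if (i < k)%N then A i else B.
  have mA' i : measurable (A' i) by rewrite /A'; case: ifP.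
  have A'k : A' k = B by rewrite /A' ltnn.
  have := iid_cylinder k.+1 mA'.
  rewrite big_nat_recr//= A'k => H.
  rewrite -[LHS](_ : P (\bigcap_(i in `I_k.+1) xi i @^-1` A' i) = _); last first.
    congr (P _); apply/seteqP; split => [w Hw|w [Hw Bw] i /= ik].
      split => [i /= ik|]; first by have := Hw i (ltnW ik); rewrite /A' /= ik.
      by have := Hw k (ltnSn k); rewrite /A' /= ltnn.
    by rewrite /A'; case: ifPn => [|nik]; [exact: Hw|have -> : i = k by lia].
  rewrite H; congr (_ * _)%E; apply: eq_big_nat => i /andP[_ ik].
  by rewrite /A' ik.
- move=> _; rewrite -[X in (X < _)%E]/(P (setT `&` xi k @^-1` B)) setTI.
  by rewrite (le_lt_trans (probability_le1 P mxB)) ?ltry.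
Qed.

(** Independence makes the joint law of the past and [xi k] a product measure, so Fubini integrates
    the fresh variable out. This plays the role of conditional expectation. *)
Lemma integral_past k (F : past k * T -> R) : bounded_measurable F ->
  \int[P]_w F (to_past k w, xi k w) = \int[P]_w \int[nu]_y F (to_past k w, y).
Proof.
move=> bF.
have mpair : measurable_fun [set: Omega] (fun w => (to_past k w, xi k w) : past k * T).
  by apply: measurable_fun_pair => //; exact: measurable_to_past.
pose law : probability (past k) R := distribution P (@to_past k : {RV P >-> past k}).
have bFn := bounded_measurable_fubini law nu bF.
transitivity (\int[law]_w \int[nu]_y F (w, y)); last first.
  rewrite /Rintegral; congr fine.
  rewrite integral_distribution//; first by apply/measurable_EFinP; have [] := bFn.
  apply: bounded_measurable_integrable.
  exact: (bounded_measurable_comp (@measurable_to_past k) bFn).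
rewrite -bounded_fubini_prod// /Rintegral; congr fine.
have -> : (\int[law \x nu]_z (F z)%:E =
    \int[pushforward P (fun w => (to_past k w, xi k w) : past k * T)]_z (F z)%:E)%E.
  apply: eq_measure_integral => A mA _.
  apply: product_measure_unique => // B C mB mC.
  exact: past_independent.
rewrite integral_pushforward//; first by apply/measurable_EFinP; have [] := bF.
rewrite preimage_setT; apply: bounded_measurable_integrable.
exact: (bounded_measurable_comp mpair bF).
Qed.

End past.

(** * The random walk *)

Section random_walk.
Context {R : realType} {G : topologicalGroupType}.
Context (metrizableG : metrizable R G) (cptG : compact [set: G]).
Context {d : measure_display} {Omega : measurableType d} (P : probability Omega R).
Context (xi : nat -> {RV P >-> borel G}) (nu : probability (borel G) R).
Context (xi_iid : iid_with_law xi nu).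
Implicit Types (f h : G -> R).

Definition walk (n : nat) (omega : Omega) : G := (\prod_(i < n.+1) (xi i omega : G))%g.

Lemma walkS n omega : walk n.+1 omega = (walk n omega * (xi n.+1 omega : G))%g.
Proof. by rewrite /walk big_ord_recr. Qed.

(** Stated along a map [p] so that one induction serves both [Omega] and its coarsening [past xi k],
    where only the first [k] variables are known to be measurable. *)
Lemma measurable_walk_gen d' (T : measurableType d') (p : T -> Omega) n :
  (forall i, (i <= n)%N -> measurable_fun [set: T] (fun w => xi i (p w))) ->
  measurable_fun [set: T] (fun w => walk n (p w) : borel G).
Proof.
elim: n => [|n IH] mxi.
  by under eq_fun do rewrite /walk big_ord_recl big_ord0 mulg1; exact: mxi.
under eq_fun do rewrite walkS.
have mn : measurable_fun [set: T] (fun w => walk n (p w) : borel G).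
  by apply: IH => i il; apply: mxi; exact: leqW.
exact: (measurable_funMg metrizableG cptG mn (mxi n.+1 (leqnn _))).
Qed.

Lemma measurable_walk n : measurable_fun [set: Omega] (walk n : Omega -> borel G).
Proof. by apply: (@measurable_walk_gen _ _ id) => i _; exact: measurable_funPT. Qed.

Lemma measurable_walk_past n k : (n < k)%N ->
  measurable_fun [set: past xi k] (walk n : past xi k -> borel G).
Proof.
move=> nk; apply: (@measurable_walk_gen _ (past xi k) id) => i il.
by apply: measurable_xi_past; exact: leq_ltn_trans nk.
Qed.

(** The terms are bounded martingale differences: given the first [k + 1] factors, [f (walk k.+1)]
    has mean [conv nu f (walk k)]. Hence they are pairwise orthogonal. *)
Lemma walk_increments_lln f : continuous f ->
  {ae P, forall w, cesaro (fun k => f (walk k.+1 w) - conv nu f (walk k w)) @ \oo --> (0 : R)}.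
Proof.
move=> cf; have cPf : continuous (conv nu f) by exact: conv_continuous.
have [c fc] := continuous_bounded cptG cf.
have bf := continuous_bounded_measurable cptG cf.
have bPf := continuous_bounded_measurable cptG cPf.
have Pfc x : `|conv nu f x| <= c.
  by apply: bint_norm_le => [|y]; [exact: bounded_measurable_lmul|exact: fc].
apply: (@orthogonal_lln _ _ _ P (fun k w => f (walk k.+1 w) - conv nu f (walk k w)) (c + c)).
- move=> k; apply: bounded_measurableB.
    exact: (bounded_measurable_comp (measurable_walk k.+1) bf).
  exact: (bounded_measurable_comp (measurable_walk k) bPf).
- by move=> k w; rewrite (le_trans (ler_normB _ _))// lerD.
- move=> j k jk.
  (* Since [j < k], everything except the last factor [xi k.+1] of [walk k.+1] is determined by the
     past; that factor becomes the second coordinate, over which the second difference integrates to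
     0. *)
  pose F (z : past xi k.+1 * borel G) :=
    (f (walk j.+1 z.1) - conv nu f (walk j z.1)) *
    (f (walk k z.1 * (z.2 : G))%g - conv nu f (walk k z.1)).
  have mfst n : (n <= k)%N -> measurable_fun [set: past xi k.+1 * borel G]
      (fun z : past xi k.+1 * borel G => walk n z.1 : borel G).
    move=> nk; have mw := @measurable_walk_past n k.+1 nk.
    exact: (measurableT_comp mw (@measurable_fst _ _ (past xi k.+1) (borel G))).
  have bF : bounded_measurable F.
    apply: bounded_measurableM; apply: bounded_measurableB.
    - exact: (bounded_measurable_comp (mfst j.+1 jk) bf).
    - exact: (bounded_measurable_comp (mfst j (ltnW jk)) bPf).
    - exact: (measurable_mulg_prod metrizableG cptG cf (mfst k (leqnn k)) measurable_snd).
    - exact: (bounded_measurable_comp (mfst k (leqnn k)) bPf).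
  transitivity (\int[P]_w F (to_past xi k.+1 w, xi k.+1 w)).
    by apply: eq_Rintegral => w _; rewrite /F /= (walkS k).
  rewrite (integral_past xi_iid bF) -[RHS](bint_cst P).
  apply: eq_Rintegral => w _; rewrite /F /=.
  have b1 : bounded_measurable (fun y : borel G => f (walk k w * (y : G))%g).
    exact: bounded_measurable_lmul.
  rewrite bintZ; last by apply: bounded_measurableB => //; exact: bounded_measurable_cst.
  rewrite bintB//; last exact: bounded_measurable_cst.
  by rewrite bint_cst subrr mulr0.
Qed.

(** Replacing [f (walk k.+1)] by [f (walk k)] adds a telescoping difference, which is negligible in
    the mean. *)
Lemma conv_lln f : continuous f ->
  {ae P, forall w, cesaro (fun k => f (walk k w) - conv nu f (walk k w)) @ \oo --> (0 : R)}.
Proof.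
move=> cf; apply: filterS (walk_increments_lln cf) => w.
have [c fc] := continuous_bounded cptG cf.
have := @cvg_cesaro_shift _ (fun k => f (walk k w)) c (fun k => fc _).
by apply: cvg_cesaroD => k; ring.
Qed.

(** Each further iterate adds the difference treated by [conv_lln] for the continuous function
    [iter k (conv nu) f]. *)
Lemma iter_conv_lln k f : continuous f -> {ae P, forall w,
  cesaro (fun n => f (walk n w) - iter k (conv nu) f (walk n w)) @ \oo --> (0 : R)}.
Proof.
move=> cf; elim: k => [|k IH].
  apply: nearW => w /=; under eq_fun do rewrite subrr.
  suff -> : cesaro (fun=> 0 : R) = cst 0 by exact: cvg_cst.
  by apply/funext => N; rewrite /cesaro big1 ?mulr0.
have := conv_lln (iter_conv_continuous cptG (nu := nu) (k := k) cf); move: IH.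
by apply: filterS2 => w; apply: cvg_cesaroD => i /=; ring.
Qed.

Lemma avg_conv_lln s f : s != [::] -> continuous f -> {ae P, forall w,
  cesaro (fun n => f (walk n w) - avg_conv nu s f (walk n w)) @ \oo --> (0 : R)}.
Proof.
move=> s0 cf; have := ae_foralln (fun k => iter_conv_lln k cf).
apply: filterS => w H.
have -> : cesaro (fun n => f (walk n w) - avg_conv nu s f (walk n w)) =
    (fun N => (size s)%:R^-1 * \sum_(k <- s)
       cesaro (fun n => f (walk n w) - iter k (conv nu) f (walk n w)) N).
  apply/funext => N; rewrite /cesaro -mulr_sumr exchange_big/= mulrCA; congr (_ * _).
  rewrite mulr_sumr; apply: eq_bigr => n _.
  by rewrite sumrB mulrBr mean_seq_const.
rewrite -[X in _ --> X](mulr0 ((size s)%:R^-1)); apply: cvgM; first exact: cvg_cst.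
exact: (cvg_sum0 s H).
Qed.

Lemma averages_lln f h : continuous f -> averages_of nu f h -> {ae P, forall w,
  cesaro (fun n => f (walk n w) - h (walk n w)) @ \oo --> (0 : R)}.
Proof.
move=> cf; elim => [|s h' s0 ah' IH]; first exact: (iter_conv_lln 0 cf).
have ch' := averages_continuous cptG cf ah'.
have := avg_conv_lln s0 ch'; move: IH.
by apply: filterS2 => w; apply: cvg_cesaroD => i /=; ring.
Qed.

Context (lambda : probability (borel G) R) (haar : normalized_haar lambda).

Lemma haar_iter_conv k f : continuous f ->
  \int[lambda]_x iter k (conv nu) f x = \int[lambda]_x f x.
Proof.
move=> cf; elim: k => //= k IH; rewrite haar_conv//.
exact: iter_conv_continuous.
Qed.

Lemma haar_averages f h : continuous f -> averages_of nu f h ->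
  \int[lambda]_x h x = \int[lambda]_x f x.
Proof.
move=> cf; elim => // s h' s0 ah' <-.
have ch' := averages_continuous cptG cf ah'.
have bm k : bounded_measurable (iter k (conv nu) h' : borel G -> R).
  by apply: continuous_bounded_measurable => //; exact: iter_conv_continuous.
rewrite /avg_conv bintZ; last exact: bounded_measurable_sum.
rewrite bint_sum//; under eq_bigr do rewrite haar_iter_conv//.
by rewrite mean_seq_const.
Qed.

Context (S : set G) (suppS : is_support nu S).
Context (denseS : closure (\bigcup_(n in [set n | (0 < n)%N]) power_set_product S n) = [set: G]).

Lemma walk_lln f : continuous f ->
  {ae P, forall w, cesaro (fun n => f (walk n w)) @ \oo --> \int[lambda]_x f x}.
Proof.
move=> cf.
(* Three errors of size [1 / (j + 1)]: the Haar integral against the constant [a], the Cesaro mean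
   of [h] against [a], and the mean of [f - h] against 0. Only countably many [j] are used, so the
   null sets can be united. *)
have Happrox (j : nat) : {ae P, forall w, \forall N \near \oo,
    `|\int[lambda]_x f x - cesaro (fun n => f (walk n w)) N| <= 3 * j.+1%:R^-1}.
  have j0 : 0 < j.+1%:R^-1 :> R by [].
  have [h [a [ah ha]]] := averages_almost_constant cptG suppS denseS cf j0.
  have ch := averages_continuous cptG cf ah.
  have la : `|\int[lambda]_x f x - a| <= j.+1%:R^-1.
    rewrite -(haar_averages cf ah) -(bint_cst lambda a) -bintB.
    - apply: bint_norm_le => //; apply: bounded_measurableB.
        exact: continuous_bounded_measurable.
      exact: bounded_measurable_cst.
    - exact: continuous_bounded_measurable.
    - exact: bounded_measurable_cst.
  apply: filterS (averages_lln cf ah) => w /cvgrPdist_le/(_ _ j0).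
  move=> [M _ HM]; exists M.+1 => // N MN.
  have := HM N (ltnW MN); rewrite sub0r normrN cesaroB => hN.
  have N0 : 0 < N%:R :> R by rewrite ltr0n (leq_trans _ MN).
  have : `|cesaro (fun n => h (walk n w)) N - a| <= j.+1%:R^-1.
    have -> : cesaro (fun n => h (walk n w)) N - a = cesaro (fun n => h (walk n w) - a) N.
      rewrite cesaroB; congr (_ - _).
      by rewrite /cesaro big_const_nat iter_addr addr0 subn0 -(mulr_natl a) mulKf ?gt_eqF.
    rewrite cesaro_norm ler_pdivrMl//.
    have := @sum_bound _ (fun n => h (walk n w) - a) j.+1%:R^-1 0 N (fun k => ha _) (leq0n N).
    by rewrite [X in _ <= `|X| + _]big_geq// normr0 add0r subn0 mulrC.
  move: hN la; rewrite !ler_norml; move: (cesaro _ N) (cesaro _ N) (j.+1%:R^-1) => u v q.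
  by move=> /andP[? ?] /andP[? ?] /andP[? ?]; apply/andP; split; lra.
have := ae_foralln Happrox; apply: filterS => w H; apply/cvgrPdist_lt => e e0.
have e30 : 0 < e / 3 by rewrite divr_gt0.
have [j _ /(_ j (leqnn j)) /= Hj] := near_infty_natSinv_lt (PosNum e30).
apply: filterS (H j) => N hN; apply: (le_lt_trans hN).
by move: Hj => /=; move: (j.+1%:R^-1) => q; lra.
Qed.

End random_walk.

(** * Step functions and complex limits *)

Section complex_convergence.
Context {R : realType}.
Implicit Types z : R[i].

Lemma normc_le_ReIm z : `|z| <= (`|complex.Re z| + `|complex.Im z|)%:C%C.
Proof.
rewrite normc_def lecR -[leRHS]ger0_norm ?addr_ge0// -sqrtr_sqr ler_wsqrtr//.
rewrite -(real_normK (num_real (complex.Re z))) -(real_normK (num_real (complex.Im z))).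
by have := mulr_ge0 (normr_ge0 (complex.Re z)) (normr_ge0 (complex.Im z)); nra.
Qed.

Lemma Re_le_normc z : `|complex.Re z|%:C%C <= `|z|.
Proof. by rewrite normc_def lecR -sqrtr_sqr ler_wsqrtr// lerDl sqr_ge0. Qed.

Lemma Im_le_normc z : `|complex.Im z|%:C%C <= `|z|.
Proof. by rewrite normc_def lecR -sqrtr_sqr ler_wsqrtr// lerDr sqr_ge0. Qed.

Let ReB z w : complex.Re (z - w) = complex.Re z - complex.Re w.
Proof. by case: z w => [a b] [a' b']. Qed.

Let ImB z w : complex.Im (z - w) = complex.Im z - complex.Im w.
Proof. by case: z w => [a b] [a' b']. Qed.

Lemma cvg_complexP (T : Type) (F : set_system T) (f : T -> R[i]^o) (l : R[i]^o) : Filter F ->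
  (f @ F --> l) <->
  ((fun t => complex.Re (f t)) @ F --> complex.Re l /\
   (fun t => complex.Im (f t)) @ F --> complex.Im l).
Proof.
move=> FF; split => [/cvgrPdist_lt fl|[/cvgrPdist_lt fr /cvgrPdist_lt fi]].
  split; apply/cvgrPdist_lt => e e0.
    have := fl e%:C%C; rewrite -[X in X < _]/(0%:C%C) ltcR => /(_ e0).
    apply: filterS => t; move/(le_lt_trans (Re_le_normc _)).
    by rewrite ltcR ReB.
  have := fl e%:C%C; rewrite -[X in X < _]/(0%:C%C) ltcR => /(_ e0).
  apply: filterS => t; move/(le_lt_trans (Im_le_normc _)).
  by rewrite ltcR ImB.
(* In the order of [R[i]] a positive radius has imaginary part 0. *)
apply/cvgrPdist_lt => -[e e']; rewrite ltcE/= => /andP[/eqP -> e0].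
have e20 : 0 < e / 2 by rewrite divr_gt0.
apply: filterS2 (fr _ e20) (fi _ e20) => t hr hi.
apply: (le_lt_trans (normc_le_ReIm _)); rewrite ltcR ReB ImB; lra.
Qed.

End complex_convergence.

(** * Time averages of step functions *)

Section step_functions.
Context {R : realType}.

Definition step (T : Type) (g : nat -> T) (t : R) : T := g `|Num.floor t|%N.

Lemma stepE (T : Type) (g : nat -> T) n (t : R) : n%:R <= t < n.+1%:R -> step g t = g n.
Proof.
move=> nt; rewrite /step (_ : Num.floor t = n%:Z)//.
by apply: floor_def; rewrite -[(n%:Z + 1)]/(Posz (n + 1)) addn1.
Qed.

Lemma floor_interval (t : R) : 0 <= t -> exists n : nat, n%:R <= t < n.+1%:R.
Proof.
move=> t0; exists (Num.truncn t); exact: truncn_itv.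
Qed.

Lemma step_measurable d (T : measurableType d) (g : nat -> T) :
  measurable_fun (`[0, +oo[ : set R) (step g).
Proof.
move=> _ A mA.
rewrite (_ : _ `&` _ = \bigcup_(n in [set n | A (g n)]) `[n%:R, n.+1%:R[%classic).
  by apply: bigcup_measurable => n _; exact: measurable_itv.
apply/seteqP; split => [t [/=]|t [n /= An]]; rewrite !in_itv/=.
  rewrite andbT => t0 At; have [n nt] := floor_interval t0.
  by exists n => /=; [rewrite -(stepE g nt)|rewrite in_itv].
move=> nt; rewrite (stepE g nt); split => //.
by rewrite andbT; have /andP[h _] := nt; rewrite (le_trans _ h).
Qed.

Context (u : nat -> R) (c : R) (uc : forall n, `|u n| <= c).
Local Notation mu := (@lebesgue_measure R).

Lemma step_integrable (a b : R) b0 b1 : 0 <= a ->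
  mu.-integrable [set` Interval (BSide b0 a) (BSide b1 b)] (EFin \o step u).
Proof.
move=> a0.
have muI : (mu [set` Interval (BSide b0 a) (BSide b1 b)] < +oo)%E.
  by rewrite lebesgue_measure_itv/=; case: ifP; rewrite ?ltry.
have mstep : measurable_fun [set` Interval (BSide b0 a) (BSide b1 b)] (step u).
  have m0 : measurable (`[0, +oo[%classic : set R) by exact: measurable_itv.
  apply: (measurable_funS m0 _ (step_measurable u)) => t /=.
  rewrite !in_itv/= andbT => /andP[h _]; apply: le_trans a0 _.
  by move: h; case: b0 {muI} => //= /ltW.
apply: (@le_integrable _ _ _ mu _ (measurable_itv _) _ (cst c%:E)).
- exact/measurable_EFinP.
- by move=> t _ /=; rewrite lee_fin (le_trans (uc _))// ler_norm.
- apply/integrableP; split; first exact: measurable_cst.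
  rewrite integral_cst//=.
  by rewrite lte_mul_pinfty// lee_fin.
Qed.

Lemma integral_step_nat N :
  \int[mu]_(t in `[0, N%:R[) step u t = \sum_(0 <= n < N) u n.
Proof.
elim: N => [|N IH]; first by rewrite set_itvco0 Rintegral_set0 big_geq.
rewrite (@itv_bndbnd_setU _ _ _ (BLeft N%:R)) ?bnd_simp ?ler_nat//.
rewrite Rintegral_setU//=.
- rewrite IH big_nat_recr//=; congr (_ + _).
  transitivity (\int[mu]_(t in `[N%:R, N.+1%:R[) u N).
    apply: eq_Rintegral => t; rewrite inE /= in_itv /= => nt.
    exact: stepE.
  have muI : mu (`[N%:R, N.+1%:R[%classic : set R) = 1%:E.
    rewrite lebesgue_measure_itv/= lte_fin ltr_nat ltnSn -EFinB.
    by rewrite -natr1 addrAC subrr add0r.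
  by rewrite Rintegral_cst// [X in fine X]muI mulr1.
- rewrite -itv_bndbnd_setU ?bnd_simp ?ler_nat//; exact: step_integrable.
- by apply/disj_setPS => t /= []; rewrite !in_itv/= => /andP[_ h1] /andP[h2 _]; lra.
Qed.

(** Only the last, incomplete interval is left over; its length is below one. *)
Lemma integral_step_le N (t : R) : N%:R <= t < N.+1%:R ->
  `|\int[mu]_(s in `[0, t]) step u s - \sum_(0 <= n < N) u n| <= c.
Proof.
move=> /andP[Nt tN]; have c0 : 0 <= c by exact: le_trans (normr_ge0 _) (uc 0%N).
rewrite (@itv_bndbnd_setU _ _ _ (BLeft N%:R)) ?bnd_simp//.
rewrite Rintegral_setU//=; last 2 first.
- rewrite -itv_bndbnd_setU ?bnd_simp//; exact: step_integrable.
- by apply/disj_setPS => s /= []; rewrite !in_itv/= => /andP[_ h1] /andP[h2 _]; lra.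
rewrite integral_step_nat addrAC subrr add0r.
apply: (le_trans (le_normr_Rintegral _ _)) => //; first exact: step_integrable.
have muI : mu `[N%:R, t] = (t - N%:R)%:E.
  rewrite lebesgue_measure_itv/= lte_fin; case: ifPn => //.
  by rewrite -leNgt => tN'; rewrite (_ : t = N%:R) ?subrr//; lra.
apply: (@le_trans _ _ (\int[mu]_(s in `[N%:R, t]) c)).
  apply: le_Rintegral => //.
  - have := @step_integrable N%:R t true false (ler0n _ _).
    by move=> /integrable_norm; apply: eq_integrable.
  - apply/integrableP; split; first exact: measurable_cst.
    by rewrite integral_cst//= muI ltry.
  - by move=> s _; exact: uc.
rewrite Rintegral_cst// [X in fine X]muI /= ler_piMr//.
by move: tN; rewrite -natr1; lra.
Qed.

Lemma cvg_step_average (l : R) : cesaro u @ \oo --> l ->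
  (fun t => t^-1 * \int[mu]_(s in `[0, t]) step u s) @ +oo --> l.
Proof.
move=> /cvgrPdist_le H; apply/cvgrPdist_le => e e0.
have c0 : 0 <= c by exact: le_trans (normr_ge0 _) (uc 0%N).
have e20 : 0 < e / 2 by rewrite divr_gt0.
have [M _ HM] := H _ e20.
(* The first summand puts the integer part [N] of [t] beyond [M]; the second makes the boundary
   error [|l| + c] at most [t * e / 2]. *)
pose B := M.+1%:R + (`|l| + c) / (e / 2).
exists B; split => [|t Bt]; first exact: num_real.
have q0 : 0 <= (`|l| + c) / (e / 2) by rewrite divr_ge0 ?addr_ge0// ltW.
have M0 : 0 < M.+1%:R :> R by rewrite ltr0n.
have t0 : 0 < t by move: Bt; rewrite /B; lra.
have [N Nt] := floor_interval (ltW t0).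
have Nt' := Nt; move: Nt' => /andP[N1 N2].
have MN : (M < N)%N.
  rewrite -ltnS -(ltr_nat R); move: Bt; rewrite /B; lra.
have := HM N (ltnW MN); have := integral_step_le Nt.
have lct : (`|l| + c) <= t * (e / 2).
  by rewrite -ler_pdivrMr//; move: Bt; rewrite /B; lra.
have N0 : 0 < N%:R :> R by rewrite ltr0n (leq_trans _ MN).
rewrite /cesaro; move: (\int[mu]_(s in _) _) (\sum_(0 <= n < N) _) => I s hI hs.
have {}hs : `|N%:R * l - s| <= N%:R * (e / 2).
  have -> : N%:R * l - s = N%:R * (l - N%:R^-1 * s) by rewrite mulrBr mulVKf ?gt_eqF.
  by rewrite normrM (gtr0_norm N0) ler_pM2l.
have -> : l - t^-1 * I = t^-1 * (t * l - I) by rewrite mulrBr mulKf ?gt_eqF.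
rewrite normrM normfV (gtr0_norm t0) ler_pdivrMl//.
have -> : t * l - I = (N%:R * l - s) + ((t - N%:R) * l - (I - s)) by ring.
rewrite (le_trans (ler_normD _ _))//.
have h2 : `|(t - N%:R) * l - (I - s)| <= `|l| + c.
  rewrite (le_trans (ler_normB _ _))// lerD// normrM ler_piMl//.
  by rewrite ger0_norm; move: N2; rewrite -natr1; lra.
have h3 : N%:R * (e / 2) <= t * (e / 2) by rewrite ler_pM2r.
by lra.
Qed.

End step_functions.

(** * Uniform distribution *)

Section uniform_distribution.
Context {R : realType} {G : topologicalGroupType}.
Context (metrizableG : metrizable R G) (cptG : compact [set: G]).
Context (lambda : probability (borel G) R) (haar : normalized_haar lambda).
Context {d : measure_display} {Omega : measurableType d} (P : probability Omega R).
Context (xi : nat -> {RV P >-> borel G}) (nu : probability (borel G) R).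
Context (xi_iid : iid_with_law xi nu) (S : set G) (suppS : is_support nu S).

(** The null set of [walk_lln] depends on [f]. It is fixed once for the countable family [psi];
    linearity and uniform approximation within [e / 4] then reach every continuous [f] outside
    it. *)
Lemma walk_lln_all :
  closure (\bigcup_(n in [set n | (0 < n)%N]) power_set_product S n) = [set: G] ->
  {ae P, forall w, forall f : G -> R, continuous f ->
    cesaro (fun n => f (walk xi n w)) @ \oo --> \int[lambda]_x f x}.
Proof.
move=> denseS; have [dist [d0 dC dt dn]] := metrizableG.
have [psi [cpsi approx]] := countable_approximation d0 dC dt dn cptG.
have := ae_foralln (fun n => ae_foralln (fun i =>
  walk_lln metrizableG cptG xi_iid haar suppS denseS (cpsi n i))).
apply: filterS => w H f cf; apply/cvgrPdist_lt => e e0.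
have e40 : 0 < e / 4 by rewrite divr_gt0.
have [n [m [c Hc]]] := approx f _ cf e40.
pose h x := \sum_(0 <= i < m) c i * psi n i x.
have ch : continuous h.
  apply: continuous_sumr => i x; apply: cvgM; [exact: cvg_cst|exact: cpsi].
have bm g : continuous g -> bounded_measurable (g : borel G -> R).
  exact: continuous_bounded_measurable.
have bpsi i : bounded_measurable (fun x : borel G => c i * psi n i x).
  by apply: bounded_measurableZ; exact: bm.
have Hh : cesaro (fun n => h (walk xi n w)) @ \oo --> \int[lambda]_x h x.
  have -> : \int[lambda]_x h x = \sum_(0 <= i < m) c i * \int[lambda]_x psi n i x.
    by rewrite /h bint_sum//; apply: eq_bigr => i _; rewrite bintZ//; exact: bm.
  have -> : cesaro (fun n => h (walk xi n w)) =
      (fun N => \sum_(0 <= i < m) c i * cesaro (fun k => psi n i (walk xi k w)) N).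
    apply/funext => N; rewrite /cesaro /h exchange_big/= mulr_sumr.
    by apply: eq_bigr => i _; rewrite -mulr_sumr mulrCA.
  elim: m {h ch Hc} => [|m IH].
    rewrite big_geq// (_ : (fun N => _) = cst 0); first exact: cvg_cst.
    by apply/funext => N; rewrite big_geq.
  rewrite big_nat_recr//= (_ : (fun N => _) = (fun N => \sum_(0 <= i < m)
      c i * cesaro (fun k => psi n i (walk xi k w)) N) \+
      (fun N => c m * cesaro (fun k => psi n m (walk xi k w)) N)).
    by apply: cvgD => //; apply: cvgM; [exact: cvg_cst|exact: H].
  by apply/funext => N; rewrite big_nat_recr.
have hl : `|\int[lambda]_x f x - \int[lambda]_x h x| <= e / 4.
  rewrite -bintB; [|exact: bm|exact: bm].
  apply: bint_norm_le => // ; apply: bounded_measurableB; exact: bm.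
have /cvgrPdist_lt/(_ _ e40) [M _ HM] := Hh.
exists M.+1 => // N MN; have hN := HM N (ltnW MN).
have N0 : 0 < N%:R :> R by rewrite ltr0n (leq_trans _ MN).
have hc : `|cesaro (fun n => f (walk xi n w)) N - cesaro (fun n => h (walk xi n w)) N| <= e / 4.
  rewrite -[leLHS]/`|(fun N => cesaro _ N - cesaro _ N) N| -cesaroB cesaro_norm.
  rewrite ler_pdivrMl//.
  have := @sum_bound _ (fun n => f (walk xi n w) - h (walk xi n w)) (e / 4) 0 N
    (fun k => Hc _) (leq0n N).
  by rewrite [X in _ <= `|X| + _]big_geq// normr0 add0r subn0 mulrC.
move: hl hN hc; move: (cesaro _ N) (cesaro _ N) => u v.
rewrite !ler_norml !ltr_norml => /andP[? ?] /andP[? ?] /andP[? ?].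
by apply/andP; split; lra.
Qed.

Lemma realC_mul (a x y : R) : (a%:C * (x +i* y) = (a * x) +i* (a * y))%C.
Proof. by simpc. Qed.

Lemma ud_of_cesaro (g : nat -> G) :
  (forall f : G -> R, continuous f -> cesaro (f \o g) @ \oo --> \int[lambda]_x f x) ->
  ud lambda g.
Proof.
move=> H; split; first exact: (@step_measurable R _ (borel G) g).
have avg (f : G -> R) : continuous f ->
    (fun t => t^-1 * \int[@lebesgue_measure R]_(s in `[0, t]) f (g `|Num.floor s|%N))
      @ +oo --> \int[lambda]_x f x.
  move=> cf; have [c fc] := continuous_bounded cptG cf.
  exact: (cvg_step_average (fun n => fc (g n)) (H f cf)).
move=> phi cphi; apply/cvg_complexP; split.
  rewrite (_ : (fun t => _) = (fun t => t^-1 * \int[@lebesgue_measure R]_(s in `[0, t])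
    complex.Re (phi (g `|Num.floor s|%N)))).
    by apply: (avg (fun x => complex.Re (phi x))) => x; have /cvg_complexP[] := cphi x.
  by apply/funext => t; rewrite /Cintegral realC_mul.
rewrite (_ : (fun t => _) = (fun t => t^-1 * \int[@lebesgue_measure R]_(s in `[0, t])
    complex.Im (phi (g `|Num.floor s|%N)))).
  by apply: (avg (fun x => complex.Im (phi x))) => x; have /cvg_complexP[] := cphi x.
by apply/funext => t; rewrite /Cintegral realC_mul.
Qed.

Lemma ud_haar_eq0 (g : nat -> G) (f : G -> R) : ud lambda g -> continuous f ->
  (forall n, f (g n) = 0) -> \int[lambda]_x f x = 0.
Proof.
move=> [_ Hg] cf fg0.
have cfC : continuous (fun x => (f x)%:C%C : R[i]^o).
  by move=> x; apply/cvg_complexP; split => /=; [exact: cf|exact: cvg_cst].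
have /cvg_complexP[+ _] := Hg _ cfC.
rewrite (_ : (fun t => _) = cst 0).
  move=> h; apply: (cvg_unique _ h (cvg_cst _)); exact: norm_hausdorff.
apply/funext => t; rewrite /Cintegral realC_mul /=.
under eq_Rintegral do rewrite fg0.
by rewrite Rintegral_cst//= mul0r mulr0.
Qed.

(** Finitely many translates of the set where [f > f p / 2] cover [G], so a finite sum of translates
    of [f] is at least [f p / 2] everywhere. All translates have the same integral, which therefore
    cannot vanish. *)
Lemma haar_continuous_gt0 (f : G -> R) p : continuous f -> (forall x, 0 <= f x) ->
  0 < f p -> 0 < \int[lambda]_x f x.
Proof.
move=> cf f0 fp.
have fp20 : 0 < f p / 2 by rewrite divr_gt0.
have := cptG; rewrite compact_cover => /(_ G setT (fun c => [set x | f p / 2 < f (c * x)%g])).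
case=> [c _|x _|D _ cD].
- have /continuousP := continuous_lmul (a := c) cf.
  by move=> /(_ _ (@interval_open _ (BRight (f p / 2)) +oo%O isT isT)); rewrite set_itvE.
- exists (p * x^-1)%g => //=; rewrite mulgVK; lra.
have bfc c : bounded_measurable (fun x : borel G => f (c * (x : G))%g).
  exact: bounded_measurable_lmul.
rewrite lt_neqAle eq_sym Rintegral_ge0 ?andbT//; apply/eqP => int0.
have : f p / 2 <= \int[lambda]_x \sum_(c <- enum_fset D) f (c * (x : G))%g.
  rewrite -[leLHS](bint_cst lambda); apply: ler_bint => [||x].
  - exact: bounded_measurable_cst.
  - exact: bounded_measurable_sum.
  - have [c Dc /= /ltW cx] := cD x I; rewrite (le_trans cx)// (big_rem c)//= lerDl.
    exact: sumr_ge0.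
rewrite bint_sum//; under eq_bigr do rewrite haar_lmul// int0.
by rewrite big1//; lra.
Qed.

Lemma dense_of_ud : {ae P, forall w, ud lambda (fun n => walk xi n w)} ->
  closure (\bigcup_(n in [set n | (0 < n)%N]) power_set_product S n) = [set: G].
Proof.
move=> Hud; have [dist [d0 dC dt dn]] := metrizableG.
have [clS nuS _] := suppS.
have mS : measurable (S : set (borel G)).
  by rewrite -[S]setCK; apply: measurableC; apply: sub_sigma_algebra; exact: closed_openC.
have inS : {ae P, forall w, forall n, S (xi n w)}.
  apply: ae_foralln => n; exists (~` (xi n @^-1` S)); split.
  - by apply: measurableC; exact: preimage_xi_measurable.
  - apply: (etrans (probability_setC P (preimage_xi_measurable xi n mS))).
    by have [_ law] := xi_iid; rewrite [X in (1 - X)%E](law n S mS) nuS subee.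
  - by move=> w.
(* Two almost sure events meet; this single path is enough for density. *)
have [w [udw Sw]] : exists w, ud lambda (fun n => walk xi n w) /\ forall n, S (xi n w).
  apply: contrapT => /forallNP H.
  have := filterI Hud inS; move=> [A [mA PA0 subA]].
  have AT : A = setT by apply/seteqP; split => // w _; apply: subA; exact: H.
  by move: PA0; rewrite AT probability_setT => -[/eqP]; rewrite oner_eq0.
apply/seteqP; split => // p _; apply: contrapT => np.
move: np => /existsNP[B /not_implyP[nB /set0P/negP/negPn/eqP B0]].
have [r r0 Hr] := metric_near dn nB.
(* A bump at [p] that vanishes outside a ball contained in [B], hence along the whole path, although
   its Haar integral is positive. *)
pose f x := Num.max 0 (r - dist p x).
have cf : continuous f.
  move=> x; apply: (@continuous_max _ _ (cst 0) (fun x => r - dist p x)).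
    exact: cvg_cst.
  by apply: cvgB; [exact: cvg_cst|exact: (continuous_metric dC dt dn)].
have : 0 < \int[lambda]_x f x.
  apply: (@haar_continuous_gt0 f p) => // [x|]; first by rewrite le_max lexx.
  by rewrite /f (metric_refl d0) subr0 lt_max r0 orbT.
rewrite (ud_haar_eq0 udw cf) ?ltxx// => n.
apply/max_idPl; rewrite subr_le0 leNgt; apply/negP => /Hr Bn.
have : (\bigcup_(n in [set n | (0 < n)%N]) power_set_product S n `&` B) (walk xi n w).
  split => //; exists n.+1 => //; exists (fun i => xi i w) => //= i; exact: Sw.
by rewrite B0.
Qed.

End uniform_distribution.

Theorem corollary6 (R : realType) (G : topologicalGroupType)
  (G_metrizable : metrizable R G) (G_compact : compact [set: G])
  (lambda : probability (borel G) R) (lambda_haar : normalized_haar lambda)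
  (d : measure_display) (Omega : measurableType d) (P : probability Omega R)
  (xi : nat -> {RV P >-> borel G})
  (nu : probability (borel G) R) (xi_iid : iid_with_law xi nu)
  (S : set G) (S_support : is_support nu S) :
  {ae P, forall omega,
     ud lambda (fun n => \prod_(i < n.+1) (xi i omega : G))%g} <->
  closure (\bigcup_(n in [set n | (0 < n)%N]) power_set_product S n) = [set: G].
Proof.
split.
  exact: (dense_of_ud G_metrizable G_compact lambda_haar xi_iid S_support).
move=> denseS.
apply: filterS (walk_lln_all G_metrizable G_compact lambda_haar xi_iid S_support denseS).
by move=> w Hw; exact: ud_of_cesaro.
Qed.
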